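(* Let $\mathcal{C}$ be a full trio. The following are equivalent: (i) Boundedness is decidable for asynchronous programs over $\mathcal{C}$. (ii) Finiteness is decidable for $\mathcal{C}$ (given a representation of a language $L$ in $\mathcal{C}$, decide whether $L$ is finite).
   Context: Language classes. A language class is a collection of languages over finite alphabets together with some finite representation of its languages. A full trio is a language class closed under intersection with regular languages, homomorphic images, and inverse homomorphic images. All full trios are assumed to be effective: given (a representation of) a language $L$ from $\mathcal{C}$, a regular language $R$ and a homomorphism $h$, one can compute representations in $\mathcal{C}$ of $L\cap R$, $h(L)$ and $h^{-1}(L)$. Decidability for $\mathcal C$ means that the input languages are given by their representations. Multisets. $\mathbb{M}[\Sigma]$ is the set of multisets $\mathbf{m}\colon\Sigma\to\mathbb{N}$; $\oplus$ is pointwise addition; $[\![\sigma]\!]$ is the multiset containing $\sigma$ exactly once; $|\mathbf{m}|=\sum_{\sigma\in\Sigma}\mathbf{m}(\sigma)$. For $w\in\Sigma^*$, $\mathsf{Parikh}(w)\in\mathbb{M}[\Sigma]$ maps each letter to its number of occurrences in $w$. Asynchronous programs. An asynchronous program over $\mathcal{C}$ is a tuple $\mathfrak{P}=(D,\Sigma,(L_c)_{c\in\mathfrak{C}},d_0,\mathbf{m}_0)$, where $D$ is a finite set of global states, $\Sigma$ is a finite alphabet of handler names, $\mathfrak{C}=D\times\Sigma\times D$ is the set of contexts, each $L_c\subseteq\Sigma^*$ is a language from $\mathcal{C}$, $d_0\in D$ is the initial state, and $\mathbf{m}_0\in\mathbb{M}[\Sigma]$. Configurations are pairs $(d,\mathbf{m})\in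 D\times\mathbb{M}[\Sigma]$; the initial configuration is $(d_0,\mathbf{m}_0)$. Transitions: $(d,\mathbf{m}\oplus[\![\sigma]\!])\xrightarrow{\sigma}(d',\mathbf{m}\oplus\mathbf{m}')$ iff there is $w\in L_{(d,\sigma,d')}$ with $\mathsf{Parikh}(w)=\mathbf{m}'$. A configuration is reachable if it can be obtained from the initial configuration by finitely many (possibly zero) transitions. Problem. Boundedness: given an asynchronous program $\mathfrak{P}$, is there $N\in\mathbb{N}$ such that every reachable configuration $(d,\mathbf{m})$ satisfies $|\mathbf{m}|\le N$? *)

(* Defs.v *)
From HB Require Import structures.
From mathcomp Require Import all_boot all_algebra.
From mathcomp Require Import boolp classical_sets functions cardinality.

Set Implicit Arguments.
Unset Strict Implicit.
Unset Printing Implicit Defensive.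

Local Open Scope classical_set_scope.
Local Open Scope nat_scope.

(** Kleene's partial recursive functions.  Decidability has to refer to an
    explicit model of computation: with the classical axioms available,
    a boolean-valued Rocq function deciding any given predicate exists. *)

Inductive recfun : nat -> Type :=
| RZero n : recfun n
| RSucc : recfun 1
| RProj n (i : 'I_n) : recfun n
| RComp m n (f : recfun m) (g : 'I_m -> recfun n) : recfun n
| RPrec n (f : recfun n) (g : recfun n.+2) : recfun n.+1
| RMu n (f : recfun n.+1) : recfun n.

(** [prec_graph F G k v y]: the function defined from [F] and [G] by primitive
    recursion takes the value [y] at [k :: v]. *)
Fixpoint prec_graph n (F : n.-tuple nat -> nat -> Prop)
    (G : n.+2.-tuple nat -> nat -> Prop) (k : nat) (v : n.-tuple nat) (y : nat)
    : Prop :=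
  match k with
  | 0 => F v y
  | k'.+1 => exists2 z, prec_graph F G k' v z & G [tuple of k' :: z :: v] y
  end.

(** [eval f v y]: the computation of [f] on [v] halts with result [y]. *)
Fixpoint eval n (f : recfun n) : n.-tuple nat -> nat -> Prop :=
  match f in recfun n return n.-tuple nat -> nat -> Prop with
  | RZero _ => fun _ y => y = 0
  | RSucc => fun v y => y = (thead v).+1
  | RProj _ i => fun v y => y = tnth v i
  | RComp m _ f g => fun v y =>
      exists2 u : m.-tuple nat, (forall i, eval (g i) v (tnth u i)) & eval f u y
  | RPrec _ f g => fun v y =>
      prec_graph (eval f) (eval g) (thead v) [tuple of behead v] y
  | RMu _ f => fun v y =>
      eval f [tuple of y :: v] 0 /\
      forall z, z < y -> exists u, eval f [tuple of z :: v] u.+1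
  end.

(** Problems over a set [X] of inputs presented by codes [enc x].  The
    algorithm need not halt on numbers that are not the code of an input. *)

Definition decidable_problem (X : Type) (enc : X -> nat) (P : X -> Prop) : Prop :=
  exists f : recfun 1, forall x,
    (P x -> eval f [tuple enc x] 1) /\ (~ P x -> eval f [tuple enc x] 0).

Definition computable_problem (X : Type) (enc : X -> nat) (Q : X -> nat -> Prop)
    : Prop :=
  exists f : recfun 1, forall x, exists2 y, eval f [tuple enc x] y & Q x y.

(** Finite alphabets are the sets ['I_k].  Finite sequences of numbers are
    coded by the (computable) bijection [CodeSeq.code]. *)

Notation language k := (set (seq 'I_k)).

Definition hom_ext k l (h : 'I_k -> seq 'I_l) (w : seq 'I_k) : seq 'I_l :=
  flatten (map h w).

Definition enc_word k (w : seq 'I_k) : nat := CodeSeq.code (map val w).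

Definition enc_hom k l (h : 'I_k -> seq 'I_l) : nat :=
  CodeSeq.code [seq enc_word (h a) | a <- enum 'I_k].

Record dfa (k : nat) := Dfa {
  dfa_size : nat;
  dfa_init : 'I_dfa_size;
  dfa_final : {set 'I_dfa_size};
  dfa_trans : 'I_dfa_size -> 'I_k -> 'I_dfa_size }.

Definition dfa_lang k (A : dfa k) : language k :=
  [set w | foldl (@dfa_trans k A) (dfa_init A) w \in dfa_final A].

Definition enc_dfa k (A : dfa k) : nat :=
  CodeSeq.code
    [:: dfa_size A;
        val (dfa_init A);
        CodeSeq.code [seq nat_of_bool (q \in dfa_final A)
                     | q <- enum 'I_(dfa_size A)];
        CodeSeq.code [seq CodeSeq.code [seq val (dfa_trans q a) | a <- enum 'I_k]
                     | q <- enum 'I_(dfa_size A)]].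

(** [is_rep C k r]: the number [r] is a representation of some language over
    ['I_k], namely of [lang C k r]; [lang C k r] is irrelevant otherwise. *)
Record language_class := LanguageClass {
  is_rep : forall k : nat, nat -> Prop;
  lang : forall k : nat, nat -> language k }.

Arguments is_rep : clear implicits.
Arguments lang : clear implicits.

Record representation (C : language_class) (k : nat) := Representation {
  rep_code : nat;
  rep_valid : is_rep C k rep_code }.

Definition rep_lang (C : language_class) k (r : representation C k) : language k :=
  lang C k (rep_code r).

Definition represents (C : language_class) k (r : nat) (L : language k) : Prop :=
  is_rep C k r /\ lang C k r = L.

Definition effective_inter_regular (C : language_class) : Prop :=
  computable_problem
    (fun x : {k : nat & (representation C k * dfa k)%type} =>
       let: existT k (r, A) := x in
       CodeSeq.code [:: k; rep_code r; enc_dfa A])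
    (fun x r' =>
       let: existT k (r, A) := x in
       represents C r' (rep_lang r `&` dfa_lang A)).

Definition effective_hom (C : language_class) : Prop :=
  computable_problem
    (fun x : {k : nat & {l : nat &
                (representation C k * ('I_k -> seq 'I_l))%type}} =>
       let: existT k (existT l (r, h)) := x in
       CodeSeq.code [:: k; l; rep_code r; enc_hom h])
    (fun x r' =>
       let: existT k (existT l (r, h)) := x in
       represents C r' (hom_ext h @` rep_lang r)).

Definition effective_inverse_hom (C : language_class) : Prop :=
  computable_problem
    (fun x : {k : nat & {l : nat &
                (representation C l * ('I_k -> seq 'I_l))%type}} =>
       let: existT k (existT l (r, h)) := x in
       CodeSeq.code [:: k; l; rep_code r; enc_hom h])
    (fun x r' =>
       let: existT k (existT l (r, h)) := x in
       represents C r' (hom_ext h @^-1` rep_lang r)).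

Definition full_trio (C : language_class) : Prop :=
  [/\ effective_inter_regular C, effective_hom C & effective_inverse_hom C].

Definition finiteness_decidable (C : language_class) : Prop :=
  decidable_problem
    (fun x : {k : nat & representation C k} =>
       let: existT k r := x in CodeSeq.code [:: k; rep_code r])
    (fun x => let: existT k r := x in finite_set (rep_lang r)).

Notation multiset k := {ffun 'I_k -> nat}.

Definition msingle k (a : 'I_k) : multiset k := [ffun b => nat_of_bool (b == a)].

Definition mcard k (m : multiset k) : nat := \sum_(a < k) m a.

Definition parikh k (w : seq 'I_k) : multiset k := [ffun a => count_mem a w].

Record async_program (C : language_class) := AsyncProgram {
  nstates : nat;
  nhandlers : nat;
  ctx : 'I_nstates -> 'I_nhandlers -> 'I_nstates -> representation C nhandlers;
  init_state : 'I_nstates;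
  init_mset : multiset nhandlers }.

Definition enc_program (C : language_class) (P : async_program C) : nat :=
  let D := enum 'I_(nstates P) in
  let Sigma := enum 'I_(nhandlers P) in
  CodeSeq.code
    [:: nstates P;
        nhandlers P;
        CodeSeq.code
          [seq CodeSeq.code
             [seq CodeSeq.code [seq rep_code (ctx d a d') | d' <- D]
             | a <- Sigma]
          | d <- D];
        val (init_state P);
        CodeSeq.code [seq init_mset P a | a <- Sigma]].

Section Semantics.

Variables (C : language_class) (P : async_program C).

Definition config : Type := ('I_(nstates P) * multiset (nhandlers P))%type.

Definition step (a : 'I_(nhandlers P)) (c c' : config) : Prop :=
  exists m m' : multiset (nhandlers P),
    [/\ c.2 = (m + msingle a)%R,
        c'.2 = (m + m')%R &
        exists2 w, rep_lang (ctx c.1 a c'.1) w & parikh w = m'].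

Inductive reachable : config -> Prop :=
| reachable_init : reachable (init_state P, init_mset P)
| reachable_step a c c' : reachable c -> step a c c' -> reachable c'.

Definition bounded : Prop :=
  exists N : nat, forall c : config, reachable c -> mcard c.2 <= N.

End Semantics.

Definition boundedness_decidable (C : language_class) : Prop :=
  decidable_problem (@enc_program C) (@bounded C).

(* Main.v *)
From mathcomp Require Import all_boot all_algebra.
From mathcomp Require Import boolp classical_sets functions cardinality.
Require Import Defs.

Set Implicit Arguments.
Unset Strict Implicit.
Unset Printing Implicit Defensive.

Local Open Scope classical_set_scope.
Local Open Scope nat_scope.

(** Finiteness reduces to boundedness by a program that spawns one word of the
    given language and then stops.

    Conversely, erasing all letters and taking the preimage of the result under
    the erasing homomorphism on one letter turns a nonempty language into an
    infinite one, so emptiness is decidable, and hence so are membership and the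
    length bounds [L <= {u | size u < N}].  Boundedness is then decided by
    searching in parallel for two kinds of certificates.  A bounded program has
    a finite list of configurations that is closed under steps.  In an unbounded
    one, either some reachable configuration enables a context with an infinite
    language, or the reachable part is finitely branching and infinite, and then
    Koenig's lemma and Dickson's lemma yield a run from a configuration to a
    strictly larger one; both situations imply unboundedness. *)

(** * Computable families of numbers *)

(* Families over an arbitrary type, because the algorithms need only halt on the
   codes of inputs. *)
Definition comp X n (e : X -> n.-tuple nat) (F : X -> nat) : Prop :=
  exists f : recfun n, forall x, eval f (e x) (F x).

(** The new variable goes to the head of the tuple, where [RPrec] expects its counter and [RMu] its
    search variable. *)
Definition ext X n (e : X -> n.-tuple nat) (y : X * nat) : n.+1.-tuple nat :=
  [tuple of y.2 :: e y.1].

Lemma comp_eq X n (e : X -> n.-tuple nat) (F G : X -> nat) :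
  F =1 G -> comp e F -> comp e G.
Proof. by move=> FG [f Hf]; exists f => x; rewrite -FG. Qed.

Lemma comp_pre X Y n (e : X -> n.-tuple nat) (h : Y -> X) (F : X -> nat) :
  comp e F -> comp (fun y => e (h y)) (fun y => F (h y)).
Proof. by case=> f Hf; exists f. Qed.

Lemma comp_tnth X n (e : X -> n.-tuple nat) (i : 'I_n) :
  comp e (fun x => tnth (e x) i).
Proof. by exists (RProj i). Qed.

(** This is [RComp] for families. As [h] may change the type of inputs, it also serves to drop,
    permute or specialise variables. *)
Lemma comp_subst X Y m n (e : X -> n.-tuple nat) (e' : Y -> m.-tuple nat)
    (h : X -> Y) (F : Y -> nat) :
  comp e' F -> (forall i, comp e (fun x => tnth (e' (h x)) i)) ->
  comp e (fun x => F (h x)).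
Proof.
move=> [f Hf] /choice [g Hg]; exists (RComp f g) => x /=.
by exists (e' (h x)).
Qed.

Lemma comp_code1 X Y n (e : X -> n.-tuple nat) (c : Y -> nat)
    (h : X -> Y) (F : Y -> nat) :
  comp (fun y => [tuple c y]) F -> comp e (fun x => c (h x)) ->
  comp e (fun x => F (h x)).
Proof.
by move=> cF ch; apply: (comp_subst (h := h) cF) => i; rewrite [i]ord1; apply: ch.
Qed.

Section Closure.

Variables (X : Type) (n : nat) (e : X -> n.-tuple nat).
Implicit Types (F G : X -> nat) (b c : X -> bool).

Lemma comp_weak F : comp e F -> comp (ext e) (fun y => F y.1).
Proof.
move=> cF; apply: (comp_subst (h := fst) cF) => i.
apply: comp_eq (comp_tnth _ (lift ord0 i)) => -[x j].
by rewrite (tnth_nth 0) [RHS](tnth_nth 0).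
Qed.

Lemma comp_weak_eq (F : X * nat -> nat) G :
  (forall x i, G x = F (x, i)) -> comp e G -> comp (ext e) F.
Proof. by move=> GF /comp_weak; apply: comp_eq => -[x i]; apply: GF. Qed.

Lemma comp_var : comp (ext e) (fun y => y.2).
Proof. exact: comp_eq (comp_tnth _ ord0). Qed.

Lemma comp_succ F : comp e F -> comp e (fun x => (F x).+1).
Proof.
move=> cF; have cS : comp (fun i => [tuple i]) succn by exists RSucc.
exact: (comp_code1 (h := F) cS cF).
Qed.

Lemma comp_zero : comp e (fun=> 0).
Proof. by exists (RZero n). Qed.

Lemma comp_const m : comp e (fun=> m).
Proof. by elim: m => [|m /comp_succ]; [apply: comp_zero|]. Qed.

(** The step program is only required to halt at indices below [N]; [comp_if] relies on this for
    [N = 0]. *)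
Lemma eval_prec (f : recfun n) (g : recfun n.+2) x (N a : nat) (B : nat -> nat -> nat) :
  eval f (e x) a ->
  (forall i, i < N ->
     eval g [tuple of i :: iteri i B a :: e x] (iteri i.+1 B a)) ->
  eval (RPrec f g) [tuple of N :: e x] (iteri N B a).
Proof.
move=> Hf Hg /=; rewrite theadE.
rewrite (_ : [tuple of behead [tuple of N :: e x]] = e x); last exact: val_inj.
elim: N Hg => [//|N IH] Hg /=.
by exists (iteri N B a); [apply: IH => i iN; apply/Hg/ltnW | apply: Hg].
Qed.

Lemma comp_iteri (A N : X -> nat) (B : X -> nat -> nat -> nat) :
  comp e A -> comp (ext (ext e)) (fun y => B y.1.1 y.2 y.1.2) -> comp e N ->
  comp e (fun x => iteri (N x) (B x) (A x)).
Proof.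
move=> [f Hf] [g Hg] cN.
have cR : comp (ext e) (fun y => iteri y.2 (B y.1) (A y.1)).
  exists (RPrec f g) => -[x i]; apply: eval_prec => // j _.
  exact: (Hg (x, iteri j (B x) (A x), j)).
apply: (comp_subst (h := fun x => (x, N x)) cR) => i.
case: (unliftP ord0 i) => [j ->|->].
  apply: comp_eq (comp_tnth _ j) => x.
  by rewrite (tnth_nth 0) [RHS](tnth_nth 0).
exact: comp_eq cN.
Qed.

(* [RComp] is strict, primitive recursion is not: at [0] it does not run the
   step function. *)
Lemma comp_if b F G :
  comp e (fun x => b x) ->
  comp (fun y : {x | b x} => e (val y)) (fun y => F (val y)) ->
  comp e G -> comp e (fun x => if b x then F x else G x).
Proof.
move=> cb [f Hf] [g Hg].
have cR : comp (fun x => [tuple of nat_of_bool (b x) :: e x])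
            (fun x => if b x then F x else G x).
  pose p := RComp f (fun i => RProj (lift ord0 (lift ord0 i)) : recfun n.+2).
  exists (RPrec g p) => x.
  have -> : (if b x then F x else G x) = iteri (b x) (fun _ _ => F x) (G x).
    by case: (b x).
  apply: eval_prec => //; case bx: (b x) => // -[] // _ /=.
  exists (e x); last exact: (Hf (exist _ x bx)).
  by move=> i; rewrite (tnth_nth 0) [RHS](tnth_nth 0).
apply: (comp_subst (h := id) cR) => i.
case: (unliftP ord0 i) => [j ->|->].
  apply: comp_eq (comp_tnth _ j) => x.
  by rewrite (tnth_nth 0) [RHS](tnth_nth 0).
exact: comp_eq cb.
Qed.

(** [RMu] looks for the least zero, so it is run on the negation of [p]; it halts because every
    input has a witness. *)
Lemma comp_search (p : X -> nat -> bool) :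
  comp (ext e) (fun y => p y.1 y.2) -> (forall x, exists i, p x i) ->
  exists2 F, comp e F & forall x, p x (F x).
Proof.
move=> [f Hf] exp.
have cN : comp (fun t : bool => [tuple nat_of_bool t]) (fun t => ~~ t).
  exists (RPrec (RComp RSucc (fun=> RZero 0)) (RZero 2)) => -[] /=.
    by exists 1 => //; exists [tuple 0] => // i; rewrite (tnth_nth 0) [i]ord1.
  by exists [tuple 0] => // i; rewrite (tnth_nth 0) [i]ord1.
have [g Hg] : comp (ext e) (fun y => ~~ p y.1 y.2).
  by apply: (comp_code1 (h := fun y => p y.1 y.2) cN); exists f.
exists (fun x => ex_minn (exp x)); last by move=> x; case: ex_minnP.
exists (RMu g) => x /=; case: ex_minnP => m pm minm; split.
  by have := Hg (x, m); rewrite /= pm.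
move=> z zm; exists 0; have := Hg (x, z); rewrite /= (_ : p x z = false) //.
by apply/negbTE/negP => /minm; rewrite leqNgt zm.
Qed.

End Closure.

Lemma comp_iteri_eq X n (e : X -> n.-tuple nat)
    (A N : X -> nat) (B : X -> nat -> nat -> nat) F :
  (forall x, iteri (N x) (B x) (A x) = F x) ->
  comp e A -> comp (ext (ext e)) (fun y => B y.1.1 y.2 y.1.2) -> comp e N ->
  comp e F.
Proof. by move=> BF cA cB cN; apply: comp_eq BF (comp_iteri cA cB cN). Qed.

Lemma comp_add X n (e : X -> n.-tuple nat) F G :
  comp e F -> comp e G -> comp e (fun x => F x + G x).
Proof.
move=> cF cG; apply: (comp_iteri_eq (B := fun _ _ z => z.+1) _ cG _ cF).
  by move=> x; elim: (F x) => //= m ->.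
exact/comp_succ/comp_weak/comp_var.
Qed.

Lemma comp_pred X n (e : X -> n.-tuple nat) F :
  comp e F -> comp e (fun x => (F x).-1).
Proof.
(* The last index of a loop of length [F x] is the predecessor of [F x]. *)
apply: (comp_iteri_eq (B := fun _ i _ => i) _ (comp_zero e)); last exact: comp_var.
by move=> x; case: (F x).
Qed.

Lemma comp_sub X n (e : X -> n.-tuple nat) F G :
  comp e F -> comp e G -> comp e (fun x => F x - G x).
Proof.
move=> cF; apply: (comp_iteri_eq (B := fun _ _ z => z.-1) _ cF).
  by move=> x; elim: (G x) => /= [|m ->]; rewrite ?subn0 ?subnS.
exact/comp_pred/comp_weak/comp_var.
Qed.

Lemma comp_mul X n (e : X -> n.-tuple nat) F G :
  comp e F -> comp e G -> comp e (fun x => F x * G x).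
Proof.
move=> cF cG; move: cF.
apply: (comp_iteri_eq (B := fun x _ z => G x + z) _ (comp_zero e)).
  by move=> x; elim: (F x) => //= m ->.
by apply: comp_add (comp_weak (comp_weak cG)) _; apply/comp_weak/comp_var.
Qed.

Lemma comp_leq X n (e : X -> n.-tuple nat) F G :
  comp e F -> comp e G -> comp e (fun x => F x <= G x).
Proof.
move=> cF cG; apply: comp_eq (comp_sub (comp_const e 1) (comp_sub cF cG)) => x.
by rewrite /leq; case: (F x - G x).
Qed.

Lemma comp_and X n (e : X -> n.-tuple nat) (b c : X -> bool) :
  comp e (fun x => b x) -> comp e (fun x => c x) -> comp e (fun x => b x && c x).
Proof. by move=> cb cc; apply: comp_eq (comp_mul cb cc) => x; rewrite mulnb. Qed.

Lemma comp_not X n (e : X -> n.-tuple nat) (b : X -> bool) :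
  comp e (fun x => b x) -> comp e (fun x => ~~ b x).
Proof.
by move=> cb; apply: comp_eq (comp_sub (comp_const e 1) cb) => x; case: (b x).
Qed.

Lemma comp_or X n (e : X -> n.-tuple nat) (b c : X -> bool) :
  comp e (fun x => b x) -> comp e (fun x => c x) -> comp e (fun x => b x || c x).
Proof.
move=> cb cc; apply: comp_eq (comp_not (comp_and (comp_not cb) (comp_not cc))) => x.
by rewrite negb_and !negbK.
Qed.

Lemma comp_imp X n (e : X -> n.-tuple nat) (b c : X -> bool) :
  comp e (fun x => b x) -> comp e (fun x => c x) -> comp e (fun x => b x ==> c x).
Proof.
by move=> cb cc; apply: comp_eq (comp_or (comp_not cb) cc) => x; rewrite implybE.
Qed.

Lemma comp_eqn X n (e : X -> n.-tuple nat) F G :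
  comp e F -> comp e G -> comp e (fun x => F x == G x).
Proof.
move=> cF cG; apply: comp_eq (comp_and (comp_leq cF cG) (comp_leq cG cF)) => x.
by rewrite eqn_leq.
Qed.

Lemma comp_ifn X n (e : X -> n.-tuple nat) (b : X -> bool) F G :
  comp e (fun x => b x) -> comp e F -> comp e G ->
  comp e (fun x => if b x then F x else G x).
Proof. by move=> cb cF; apply: comp_if => //; apply: comp_pre cF. Qed.

Lemma comp_exp X n (e : X -> n.-tuple nat) F G :
  comp e F -> comp e G -> comp e (fun x => F x ^ G x).
Proof.
move=> cF; apply: (comp_iteri_eq (B := fun x _ z => F x * z) _ (comp_const e 1)).
  by move=> x; elim: (G x) => //= m ->; rewrite expnS.
by apply: comp_mul (comp_weak (comp_weak cF)) _; apply/comp_weak/comp_var.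
Qed.

Lemma comp_sum X n (e : X -> n.-tuple nat) (N : X -> nat) (B : X -> nat -> nat) :
  comp e N -> comp (ext e) (fun y => B y.1 y.2) ->
  comp e (fun x => \sum_(i < N x) B x i).
Proof.
move=> cN cB; move: cN.
apply: (comp_iteri_eq (B := fun x i z => z + B x i) _ (comp_zero e)).
  by move=> x; elim: (N x) => /= [|m ->]; rewrite ?big_ord0 ?big_ord_recr.
apply: comp_add; first exact/comp_weak/comp_var.
(* The summand does not see the accumulator [y.1.2], which is dropped here. *)
apply: (comp_subst (h := fun y => (y.1.1, y.2)) cB) => i.
case: (unliftP ord0 i) => [j ->|->]; last exact: comp_eq (comp_var _).
apply: comp_eq (comp_weak (comp_weak (comp_tnth e j))) => y.
by rewrite [RHS](tnth_nth 0) (tnth_nth 0).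
Qed.

Definition hasn N (p : pred nat) := has p (iota 0 N).
Definition alln N (p : pred nat) := all p (iota 0 N).

Lemma hasnP N (p : pred nat) : reflect (exists2 i, i < N & p i) (hasn N p).
Proof.
by apply: (iffP hasP) => -[i iN pi]; exists i => //; move: iN; rewrite mem_iota.
Qed.

Lemma allnP N (p : pred nat) : reflect (forall i, i < N -> p i) (alln N p).
Proof. by apply: (iffP allP) => H i iN; apply: H; move: iN; rewrite mem_iota. Qed.

Lemma comp_hasn X n (e : X -> n.-tuple nat) (N : X -> nat) (p : X -> pred nat) :
  comp e N -> comp (ext e) (fun y => p y.1 y.2) ->
  comp e (fun x => hasn (N x) (p x)).
Proof.
move=> cN cp; have cS := comp_sum (B := fun x i => p x i) cN cp.
apply: comp_eq (comp_leq (comp_const e 1) cS) => x.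
rewrite /hasn has_count -(big_mkord xpredT (fun i => p x i : nat)).
by rewrite -sum1_count [in RHS]big_mkcond /index_iota subn0; congr (0 < _).
Qed.

Lemma comp_alln X n (e : X -> n.-tuple nat) (N : X -> nat) (p : X -> pred nat) :
  comp e N -> comp (ext e) (fun y => p y.1 y.2) ->
  comp e (fun x => alln (N x) (p x)).
Proof.
move=> cN cp; have cH := comp_hasn (p := fun x i => ~~ p x i) cN (comp_not cp).
apply: comp_eq (comp_not cH) => x; rewrite /alln /hasn -all_predC.
by congr (nat_of_bool _); apply: eq_all => i /=; rewrite negbK.
Qed.

(** * Coded sequences *)

Notation code := CodeSeq.code.
Notation decode := CodeSeq.decode.

Definition nthc s i := nth 0 (decode s) i.
Definition sizec s := size (decode s).

Lemma nthc_code l i : nthc (code l) i = nth 0 l i.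
Proof. by rewrite /nthc CodeSeq.codeK. Qed.

Lemma sizec_code l : sizec (code l) = size l.
Proof. by rewrite /sizec CodeSeq.codeK. Qed.

(** As [code (a :: l)] is [2 ^ a * (code l).*2.+1], each entry strictly increases the code. This
    bounds the loop that computes [sizec]. *)
Lemma size_code l : size l <= code l.
Proof.
elim: l => //= a l IH; apply: leq_trans (leq_pmull _ _); rewrite ?expn_gt0 //.
by rewrite ltnS (leq_trans IH) // -addnn leq_addr.
Qed.

Lemma code_eq0 l : (code l == 0) = (l == [::]).
Proof. by rewrite -[0]/(code [::]) (can_eq CodeSeq.codeK). Qed.

Lemma code_cons_inj a l b m :
  (2 ^ b * m.*2.+1 == code (a :: l)) = (b == a) && (m == code l).
Proof.
rewrite -[m]CodeSeq.decodeK -[X in X == _]/(code (b :: decode m)).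
by rewrite (can_eq CodeSeq.codeK) eqseq_cons (can_eq CodeSeq.codeK).
Qed.

(* [a :: l] is read off the unique solution of [2 ^ b * (2 m + 1) = s]. *)
Lemma sum_code_cons (f : nat -> nat -> nat) a l (s := code (a :: l)) :
  \sum_(b < s) \sum_(m < s) f b m * (2 ^ b * m.*2.+1 == s) = f a (code l).
Proof.
have as_ : a < s.
  by rewrite /s /= (leq_trans (ltn_expl a (ltnSn 1))) // leq_pmulr.
have ls : code l < s.
  by rewrite /s /= (leq_trans _ (leq_pmull _ _)) ?expn_gt0 // ltnS -addnn leq_addr.
rewrite (bigD1 (Ordinal as_)) //= (bigD1 (Ordinal ls)) //= code_cons_inj !eqxx muln1.
rewrite big1 => [|m ml]; last first.
  by rewrite code_cons_inj -(inj_eq val_inj) in ml *; rewrite (negbTE ml) andbF muln0.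
rewrite big1 ?addn0 // => b ba; rewrite big1 // => m _.
by rewrite code_cons_inj -(inj_eq val_inj) in ba *; rewrite (negbTE ba) muln0.
Qed.

Lemma comp_double X n (e : X -> n.-tuple nat) F :
  comp e F -> comp e (fun x => (F x).*2).
Proof. by move=> cF; apply: comp_eq (comp_add cF cF) => x; rewrite addnn. Qed.

Lemma comp_cons X n (e : X -> n.-tuple nat) F (L : X -> seq nat) :
  comp e F -> comp e (fun x => code (L x)) -> comp e (fun x => code (F x :: L x)).
Proof.
move=> cF cL.
exact: comp_mul (comp_exp (comp_const e 2) cF) (comp_succ (comp_double cL)).
Qed.

Lemma comp_nil X n (e : X -> n.-tuple nat) : comp e (fun=> code [::]).
Proof. exact: comp_zero. Qed.

(** Pattern matching on a coded sequence. Head and tail code are both below the code, so the double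
    sum of [sum_code_cons] finds them; the empty sequence has code 0, where the sum is empty. *)
Lemma comp_uncode X n (e : X -> n.-tuple nat) (f : nat -> nat -> nat) F :
  comp (fun y : nat * nat => [tuple y.1; y.2]) (fun y => f y.1 y.2) ->
  comp e F ->
  comp e (fun x => if decode (F x) is a :: l then f a (code l) else 0).
Proof.
move=> cf cF.
have c1 : comp (fun s => [tuple s])
    (fun s => \sum_(b < s) \sum_(m < s) f b m * (2 ^ b * m.*2.+1 == s)).
  set e1 := fun s => _.
  have cs : comp e1 id by exact: comp_eq (comp_tnth _ ord0).
  apply: (comp_sum (B := fun s b => \sum_(m < s) f b m * (2 ^ b * m.*2.+1 == s)) cs).
  apply: (comp_sum (B := fun y m => f y.2 m * (2 ^ y.2 * m.*2.+1 == y.1)) (comp_weak cs)).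
  have cb : comp (ext (ext e1)) (fun y => y.1.2) by exact: comp_weak (comp_var _).
  have cm : comp (ext (ext e1)) (fun y => y.2) by exact: comp_var.
  apply: comp_mul.
    apply: (comp_subst (h := fun y => (y.1.2, y.2)) cf) => i.
    case: (unliftP ord0 i) => [j ->|->]; last exact: comp_eq cb.
    by rewrite [j]ord1; apply: comp_eq cm.
  apply: comp_eqn (comp_weak (comp_weak cs)).
  exact: comp_mul (comp_exp (comp_const _ 2) cb) (comp_succ (comp_double cm)).
apply: comp_eq (comp_code1 (h := F) c1 cF) => x.
move: (CodeSeq.decodeK (F x)); case: (decode (F x)) => [|a l] <-.
  by rewrite big_ord0.
exact: sum_code_cons.
Qed.

Lemma comp_head X n (e : X -> n.-tuple nat) F :
  comp e F -> comp e (fun x => head 0 (decode (F x))).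
Proof.
move=> cF; have cf : comp (fun y : nat * nat => [tuple y.1; y.2]) fst.
  exact: comp_eq (comp_tnth _ ord0).
by apply: comp_eq (comp_uncode (f := fun a _ => a) cf cF) => x; case: decode.
Qed.

Lemma comp_behead X n (e : X -> n.-tuple nat) F :
  comp e F -> comp e (fun x => code (behead (decode (F x)))).
Proof.
move=> cF; have cf : comp (fun y : nat * nat => [tuple y.1; y.2]) snd.
  exact: comp_eq (comp_tnth _ (lift ord0 ord0)).
by apply: comp_eq (comp_uncode (f := fun _ l => l) cf cF) => x; case: decode.
Qed.

Lemma comp_drop X n (e : X -> n.-tuple nat) F G :
  comp e F -> comp e G -> comp e (fun x => code (drop (G x) (decode (F x)))).
Proof.
move=> cF; pose B (x : X) (i z : nat) := code (behead (decode z)).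
apply: (comp_iteri_eq (B := B) _ cF).
  move=> x; elim: (G x) => [|m /= ->]; rewrite ?drop0 ?CodeSeq.decodeK //.
  by rewrite /B CodeSeq.codeK -drop1 drop_drop add1n.
exact/comp_behead/comp_weak/comp_var.
Qed.

Lemma comp_nthc X n (e : X -> n.-tuple nat) F G :
  comp e F -> comp e G -> comp e (fun x => nthc (F x) (G x)).
Proof.
move=> cF cG; apply: comp_eq (comp_head (comp_drop cF cG)) => x.
by rewrite CodeSeq.codeK -nth0 nth_drop addn0.
Qed.

(** The length is the number of nonempty suffixes, counted over all offsets below the code. *)
Lemma comp_sizec X n (e : X -> n.-tuple nat) F :
  comp e F -> comp e (fun x => sizec (F x)).
Proof.
move=> cF.
have cB : comp (ext e) (fun y => ~~ (code (drop y.2 (decode (F y.1))) <= 0)).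
  apply/comp_not/comp_leq; last exact: comp_zero.
  exact: comp_drop (comp_weak cF) (comp_var e).
apply: comp_eq (comp_sum (B := fun x i => ~~ (code (drop i (decode (F x))) <= 0)) cF cB).
move=> x; rewrite /sizec; set l := decode (F x).
have lF : size l <= F x by rewrite -[F x]CodeSeq.decodeK size_code.
rewrite -(big_mkord xpredT (fun i => ~~ (code (drop i l) <= 0) : nat)).
rewrite (big_cat_nat (leq0n _) lF) /= big_nat_cond (eq_bigr (fun=> 1)) => [|i].
  rewrite -big_nat_cond sum_nat_const_nat subn0 muln1 big_nat_cond big1 ?addn0 //.
  by move=> i /andP[/andP[li _] _]; rewrite drop_oversize.
rewrite andbT => /andP[_ il]; rewrite leqn0 code_eq0 -size_eq0 size_drop subn_eq0.
by rewrite -ltnNge il.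
Qed.

Lemma comp_mkseq X n (e : X -> n.-tuple nat) (N : X -> nat) (f : X -> nat -> nat) :
  comp e N -> comp (ext e) (fun y => f y.1 y.2) ->
  comp e (fun x => code (mkseq (f x) (N x))).
Proof.
(* The sequence is built from its end: turn [i] of the loop puts the entry of index [N x - i.+1] in
   front. *)
move=> cN cf; pose B x i z := code (f x (N x - i.+1) :: decode z).
apply: (comp_iteri_eq (B := B) _ (comp_zero e) _ cN).
  move=> x; rewrite /mkseq.
  suff H m : m <= N x -> iteri m (B x) 0 = code [seq f x i | i <- iota (N x - m) m].
    by rewrite H // subnn.
  elim: m => //= m IH mN; rewrite IH 1?ltnW // /B CodeSeq.codeK.
  by rewrite subnSK.
apply: comp_cons.
  apply: (comp_subst (h := fun y => (y.1.1, N y.1.1 - y.2.+1)) cf) => i.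
  case: (unliftP ord0 i) => [j ->|->].
    apply: comp_eq (comp_weak (comp_weak (comp_tnth e j))) => y.
    by rewrite [RHS](tnth_nth 0) (tnth_nth 0).
  apply: comp_eq (comp_sub (comp_weak (comp_weak cN)) (comp_succ (comp_var _))) => y.
  by rewrite (tnth_nth 0).
by apply: comp_eq (comp_weak (comp_var e)) => y; rewrite CodeSeq.decodeK.
Qed.

Lemma mkseq_const (c k : nat) : mkseq (fun=> c) k = nseq k c.
Proof. by rewrite /mkseq; elim: k 0 => //= k IH m; rewrite IH. Qed.

Lemma map_enum_ord T (f : nat -> T) k : [seq f (val a) | a <- enum 'I_k] = mkseq f k.
Proof. by rewrite /mkseq -val_enum_ord -map_comp. Qed.

Arguments CodeSeq.code : simpl never.

(** Computability is proved along the syntax of the term. The last case treats a term in [y.1] alone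
    and drops the variable [y.2]. *)
Ltac comp_step :=
  cbv beta;
  first [ assumption | lazymatch goal with
  | |- comp _ (fun=> code [::]) => exact: comp_nil
  | |- comp _ (fun=> ?c) => exact: comp_const
  | |- comp _ (fun x => nat_of_bool (@?b x && @?c x)) => apply: comp_and
  | |- comp _ (fun x => nat_of_bool (@?b x || @?c x)) => apply: comp_or
  | |- comp _ (fun x => nat_of_bool (@?b x ==> @?c x)) => apply: comp_imp
  | |- comp _ (fun x => nat_of_bool (~~ @?b x)) => apply: comp_not
  | |- comp _ (fun x => nat_of_bool (@?F x == @?G x)) => apply: comp_eqn
  | |- comp _ (fun x => nat_of_bool (@?F x <= @?G x)) => apply: comp_leq
  | |- comp _ (fun x => nat_of_bool (hasn (@?N x) (@?p x))) =>
      apply: (comp_hasn (N := N) (p := p))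
  | |- comp _ (fun x => nat_of_bool (alln (@?N x) (@?p x))) =>
      apply: (comp_alln (N := N) (p := p))
  | |- comp _ (fun x => code (@?F x :: @?L x)) => apply: (comp_cons (F := F) (L := L))
  | |- comp _ (fun x => code (mkseq (@?f x) (@?N x))) =>
      apply: (comp_mkseq (N := N) (f := f))
  | |- comp _ (fun x => nthc (@?F x) (@?G x)) => apply: comp_nthc
  | |- comp _ (fun x => sizec (@?F x)) => apply: comp_sizec
  | |- comp _ (fun x => (@?F x).+1) => apply: comp_succ
  | |- comp _ (fun x => @?F x + @?G x) => apply: comp_add
  | |- comp _ (fun x => @?F x - @?G x) => apply: comp_sub
  | |- comp (ext _) (fun y => y.2) => exact: comp_var
  | |- comp (ext _) snd => exact: comp_var
  | |- comp (ext _) _ =>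
      eapply comp_weak_eq; [by intros ? ?; cbn [fst snd]; reflexivity|]
  end ].

Ltac computable := repeat comp_step.

(** * Effective operations on representations *)

(* The letters and states of the automaton are handled as numbers; the start
   state is [0] and moves beyond the last state [s] are redirected to [s]. *)
Definition natdfa k s (fin : pred nat) (tr : nat -> nat -> nat) : dfa k :=
  @Dfa k s.+1 ord0 [set q : 'I_s.+1 | fin q]%SET
    (fun q a => inord (minn (tr q a) s)).

Lemma enc_natdfa k s fin tr :
  enc_dfa (natdfa k s fin tr) =
  code [:: s.+1; 0; code (mkseq (fun q => fin q : nat) s.+1);
    code (mkseq (fun q => code (mkseq (fun a => minn (tr q a) s) k)) s.+1)].
Proof.
rewrite /enc_dfa -!map_enum_ord; congr (code [:: _; _; code _; code _]).
  by apply: eq_map => q; rewrite inE.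
apply: eq_map => q; rewrite -map_enum_ord.
by congr code; apply: eq_map => a; rewrite /= inordK // ltnS geq_minr.
Qed.

Lemma comp_minn X n (e : X -> n.-tuple nat) F G :
  comp e F -> comp e G -> comp e (fun x => minn (F x) (G x)).
Proof.
by move=> cF cG; apply: comp_eq (comp_sub cF (comp_sub cF cG)) => x; rewrite minnE.
Qed.

Lemma comp_natdfa X n (e : X -> n.-tuple nat) (k s : X -> nat)
    (fin : X -> pred nat) (tr : X -> nat -> nat -> nat) :
  comp e k -> comp e s -> comp (ext e) (fun y => fin y.1 y.2) ->
  comp (ext (ext e)) (fun y => tr y.1.1 y.1.2 y.2) ->
  comp e (fun x => enc_dfa (natdfa (k x) (s x) (fin x) (tr x))).
Proof.
move=> ck cs cfin ctr.
apply: (comp_eq (fun x => esym (enc_natdfa (k x) (s x) (fin x) (tr x)))).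
do 2![computable]; apply: comp_minn; computable.
Qed.

(** Choosing for every input the output of the algorithm turns a relational problem into a
    computable family. *)
Lemma computable_problemP X (enc : X -> nat) (Q : X -> nat -> Prop) :
  computable_problem enc Q ->
  exists2 y, comp (fun x => [tuple enc x]) y & forall x, Q x (y x).
Proof.
case=> f Hf; have /choice[y Hy] x : exists y, eval f [tuple enc x] y /\ Q x y.
  by have [y] := Hf x; exists y.
by exists y => [|x]; [exists f => x|]; case: (Hy x).
Qed.

Section FullTrio.

Variables (C : language_class) (hC : full_trio C).

(** This lemma and the next two turn effective closure into operations on representations that can
    be nested inside [comp]. *)
Lemma effective_inter_dfa :
  exists2 I : forall k, representation C k -> dfa k -> representation C k,
    forall k r A, rep_lang (I k r A) = rep_lang r `&` dfa_lang A &
    forall X n (e : X -> n.-tuple nat) (k : X -> nat)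
        (r : forall x, representation C (k x)) (A : forall x, dfa (k x)),
      comp e k -> comp e (fun x => rep_code (r x)) ->
      comp e (fun x => enc_dfa (A x)) -> comp e (fun x => rep_code (I _ (r x) (A x))).
Proof.
case: hC => /computable_problemP[y cf Hy] _ _.
pose I k r A := Representation (Hy (existT _ k (r, A))).1.
exists I => [k r A|X n e k r A ck cr cA].
  exact: (Hy (existT _ k (r, A))).2.
apply: (comp_code1 (h := fun x => existT _ (k x) (r x, A x)) cf).
computable.
Qed.

Lemma effective_image :
  exists2 I : forall k l, representation C k -> ('I_k -> seq 'I_l) -> representation C l,
    forall k l r h, rep_lang (I k l r h) = hom_ext h @` rep_lang r &
    forall X n (e : X -> n.-tuple nat) (k l : X -> nat)
        (r : forall x, representation C (k x)) (h : forall x, 'I_(k x) -> seq 'I_(l x)),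
      comp e k -> comp e l -> comp e (fun x => rep_code (r x)) ->
      comp e (fun x => enc_hom (h x)) ->
      comp e (fun x => rep_code (I _ _ (r x) (h x))).
Proof.
case: hC => _ /computable_problemP[y cf Hy] _.
pose I k l r h := Representation (Hy (existT _ k (existT _ l (r, h)))).1.
exists I => [k l r h|X n e k l r h ck cl cr ch].
  exact: (Hy (existT _ k (existT _ l (r, h)))).2.
apply: (comp_code1 (h := fun x => existT _ (k x) (existT _ (l x) (r x, h x))) cf).
computable.
Qed.

Lemma effective_preimage :
  exists2 I : forall k l, representation C l -> ('I_k -> seq 'I_l) -> representation C k,
    forall k l r h, rep_lang (I k l r h) = hom_ext h @^-1` rep_lang r &
    forall X n (e : X -> n.-tuple nat) (k l : X -> nat)
        (r : forall x, representation C (l x)) (h : forall x, 'I_(k x) -> seq 'I_(l x)),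
      comp e k -> comp e l -> comp e (fun x => rep_code (r x)) ->
      comp e (fun x => enc_hom (h x)) ->
      comp e (fun x => rep_code (I _ _ (r x) (h x))).
Proof.
case: hC => _ _ /computable_problemP[y cf Hy].
pose I k l r h := Representation (Hy (existT _ k (existT _ l (r, h)))).1.
exists I => [k l r h|X n e k l r h ck cl cr ch].
  exact: (Hy (existT _ k (existT _ l (r, h)))).2.
apply: (comp_code1 (h := fun x => existT _ (k x) (existT _ (l x) (r x, h x))) cf).
computable.
Qed.

End FullTrio.

Lemma decidableP X (enc : X -> nat) (P : X -> Prop) :
  decidable_problem enc P <-> comp (fun x => [tuple enc x]) (fun x => `[< P x >]).
Proof.
split=> -[f Hf]; exists f => x.
  by case: asboolP => Px; [apply: (Hf x).1 | apply: (Hf x).2].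
by split=> Px; have := Hf x; [rewrite asboolT | rewrite asboolF].
Qed.

(** * Deciding finiteness and emptiness *)

Section Finiteness.

Variables (C : language_class) (hC : full_trio C).
Hypothesis finC : finiteness_decidable C.

Variables (X : Type) (n : nat) (e : X -> n.-tuple nat).
Variables (k : X -> nat) (r : forall x, representation C (k x)).
Hypotheses (ck : comp e k) (cr : comp e (fun x => rep_code (r x))).

Lemma comp_finite : comp e (fun x => `[< finite_set (rep_lang (r x)) >]).
Proof.
have /decidableP cf := finC.
apply: (comp_code1 (h := fun x => existT _ (k x) (r x)) cf).
computable.
Qed.

End Finiteness.

Lemma infinite_unary : ~ finite_set [set: seq 'I_1].
Proof.
move=> fin; apply: infinite_nat.
apply: sub_finite_set (finite_image size fin) => m _.
by exists (nseq m ord0) => //; rewrite size_nseq.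
Qed.

Section Emptiness.

Variables (C : language_class) (hC : full_trio C).
Hypothesis finC : finiteness_decidable C.

Variables (X : Type) (n : nat) (e : X -> n.-tuple nat).
Variables (k : X -> nat) (r : forall x, representation C (k x)).
Hypotheses (ck : comp e k) (cr : comp e (fun x => rep_code (r x))).

Lemma comp_empty : comp e (fun x => `[< rep_lang (r x) = set0 >]).
Proof.
have [Im ImE cIm] := effective_image hC.
have [Pre PreE cPre] := effective_preimage hC.
pose er l (_ : 'I_l) : seq 'I_1 := [::].
have erE l w : hom_ext (@er l) w = [::] by elim: w.
have c_er (Y : Type) m (e' : Y -> m.-tuple nat) (l : Y -> nat) :
    comp e' l -> comp e' (fun y => enc_hom (@er (l y))).
  move=> cl; apply: (comp_eq (F := fun y => code (mkseq (fun=> code [::]) (l y)))).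
    by move=> y; rewrite -map_enum_ord.
  by computable.
have c1 : comp e (fun x => rep_code (Im _ _ (r x) (@er (k x)))).
  by apply: cIm => //; [apply: comp_const | apply: c_er].
(* This preimage consists of all unary words if [rep_lang (r x)] is nonempty, and is empty
   otherwise. *)
have c2 : comp e (fun x => rep_code (Pre _ _ (Im _ _ (r x) (@er (k x))) (@er 1))).
  by apply: cPre => //; do ?apply: c_er; apply: comp_const.
apply: comp_eq (comp_finite finC (comp_const e 1) c2) => x.
congr (nat_of_bool _); apply/asboolP/asboolP; rewrite PreE ImE => H.
  apply/seteqP; split=> // w Lw; apply: infinite_unary.
  by apply: sub_finite_set H => u _; exists w; rewrite ?erE.
by rewrite H image_set0 preimage_set0.
Qed.

End Emptiness.

(** * Finiteness reduces to boundedness *)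

(** Over a finite alphabet there are only finitely many words of each length. *)
Lemma finite_languageP k (L : language k) :
  finite_set L <-> exists N, forall w, L w -> size w <= N.
Proof.
split=> [/finite_seqP[s ->]|[N LN]].
  by exists (\max_(w <- s) size w) => w ws; apply: (leq_bigmax_seq (F := size) w).
apply: (@sub_finite_set _ _ (\bigcup_(m in `I_N.+1) range (@tval m 'I_k))).
  by move=> w /LN wN; exists (size w) => //; exists (in_tuple w).
by apply: bigcup_finite => // m _; apply: finite_image; apply: finite_finset.
Qed.

Lemma msetD k (m m' : multiset k) a : (m + m')%R a = m a + m' a.
Proof. by rewrite ffunE. Qed.

Lemma mcardD k (m m' : multiset k) : mcard (m + m')%R = mcard m + mcard m'.
Proof. by rewrite /mcard -big_split; apply: eq_bigr => a _; rewrite msetD. Qed.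

Lemma mcard_single k (a : 'I_k) : mcard (msingle a) = 1.
Proof.
rewrite /mcard (bigD1 a) //= ffunE eqxx big1 // => b /negbTE ba.
by rewrite ffunE ba.
Qed.

Lemma mcard_parikh k (w : seq 'I_k) : mcard (parikh w) = size w.
Proof.
elim: w => [|a w IH]; first by rewrite /mcard big1 // => a _; rewrite ffunE.
rewrite /= -IH -add1n -(mcard_single a) -mcardD; apply: eq_bigr => b _.
by rewrite !ffunE /= eq_sym.
Qed.

Section OneShot.

Variables (C : language_class) (k : nat) (r r0 : representation C k).
Hypothesis r0_empty : rep_lang r0 = set0.

(** In state 0 the only pending task, handler 0, spawns a word of [r] and moves to state 1, which
    has no outgoing step because [r0] is empty. For [k = 0] nothing is pending and nothing runs. *)
Definition one_shot : async_program C :=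
  @AsyncProgram C 2 k
    (fun d _ d' => if (val d == 0) && (val d' == 1) then r else r0)
    ord0 [ffun a => nat_of_bool (val a == 0)].

Lemma one_shot_step a (c c' : config one_shot) :
  step a c c' -> [/\ val c.1 = 0, val c'.1 = 1 &
    exists2 m, c.2 = (m + msingle a)%R &
      exists2 w, rep_lang r w & c'.2 = (m + parikh w)%R].
Proof.
case=> m [m' [Hc Hc' [w]]] /=; case: ifP; last by rewrite r0_empty.
case/andP=> /eqP-> /eqP-> rw wm'; split=> //; exists m => //; exists w => //.
by rewrite wm'.
Qed.

(** Steps lead from state 0 to state 1, so a run has at most one of them, and the sizes reached are
    governed by the lengths of the words of [r]. *)
Lemma one_shot_bounded : bounded one_shot <-> finite_set (rep_lang r).
Proof.
rewrite finite_languageP; split=> -[N HN].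
  exists N => w rw; case: (posnP k) => [k0|k_gt0].
    case: w rw => // a w; move: (ltn_ord a); rewrite {2}k0 //.
  pose a := Ordinal k_gt0.
  have R1 : reachable ((inord 1, parikh w) : config one_shot).
    apply: (@reachable_step _ one_shot a); first exact: reachable_init.
    exists 0%R, (parikh w); split; [| by rewrite GRing.add0r|].
      by rewrite GRing.add0r; apply/ffunP => b; rewrite !ffunE.
    by exists w => //=; rewrite inordK.
  by have := HN _ R1; rewrite mcard_parikh.
exists (mcard (init_mset one_shot) + N) => c; case=> [|a c0 c1 Rc0 /one_shot_step].
  exact: leq_addr.
case=> c00 _ [m c0m [w rw ->]]; rewrite mcardD mcard_parikh leq_add ?HN //.
case: Rc0 c00 c0m => [_ /= ->|b c2 c3 _ /one_shot_step[_ -> _] //].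
by rewrite mcardD leq_addr.
Qed.

Lemma enc_one_shot :
  enc_program one_shot =
  code [:: 2; k;
    code (mkseq (fun d => code (mkseq (fun=> code (mkseq (fun d' =>
      if (d == 0) && (d' == 1) then rep_code r else rep_code r0) 2)) k)) 2);
    0; code (mkseq (fun a => a == 0 : nat) k)].
Proof.
rewrite /enc_program -!map_enum_ord; congr (code [:: _; _; code _; _; code _]).
  apply: eq_map => d; rewrite -map_enum_ord; congr code; apply: eq_map => a.
  by rewrite -map_enum_ord; congr code; apply: eq_map => d' /=; case: ifP.
by apply: eq_map => a; rewrite ffunE.
Qed.

End OneShot.

Lemma finiteness_of_boundedness (C : language_class) (hC : full_trio C) :
  boundedness_decidable C -> finiteness_decidable C.
Proof.
move=> /decidableP cB; apply/decidableP.
have [I IE cI] := effective_inter_dfa hC.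
set X : Type := ({k : nat & representation C k}); set e := fun x => _.
(* A representation of the empty language comes from the input itself, intersected with an automaton
   without final states. *)
pose r0 (x : X) := I _ (projT2 x) (natdfa (projT1 x) 0 xpred0 (fun _ _ => 0)).
have r00 x : rep_lang (r0 x) = set0.
  by rewrite IE; apply/seteqP; split=> // w []; rewrite /dfa_lang /= inE.
have ce : comp e (fun x => let: existT k r := x in code [:: k; rep_code r]).
  exact: comp_eq (comp_tnth e ord0).
have ck : comp e (@projT1 _ _).
  by apply: comp_eq (comp_nthc ce (comp_const _ 0)) => -[k r]; rewrite nthc_code.
have cr : comp e (fun x => rep_code (projT2 x)).
  by apply: comp_eq (comp_nthc ce (comp_const _ 1)) => -[k r]; rewrite nthc_code.
have cr0 : comp e (fun x => rep_code (r0 x)).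
  by apply: cI => //; apply: comp_natdfa; computable.
apply: (comp_eq (F := fun x => `[< bounded (one_shot (projT2 x) (r0 x)) >])).
  case=> k r; congr (nat_of_bool _).
  by apply/asboolP/asboolP; have [] := one_shot_bounded r (r00 (existT _ k r)).
apply: (comp_code1 (h := fun x => one_shot (projT2 x) (r0 x)) cB).
apply: (comp_eq (fun x => esym (enc_one_shot _ _))).
computable; apply: comp_ifn; computable.
Qed.

(** * Queries to the languages of a program *)

(** State [q <= l] records that the first [q] letters have matched, and [l.+1] is a sink. If some
    entry of [s] is not a letter, nothing is accepted. *)
Definition word_dfa k s : dfa k :=
  let l := sizec s in
  natdfa k l.+1 (fun q => q == l)
    (fun q a => if (q.+1 <= l) && (nthc s q == a) then q.+1 else l.+1).

(** A letter counter that saturates at [N], since [natdfa] redirects moves beyond the last state. *)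
Definition long_dfa k N : dfa k := natdfa k N (fun q => q == N) (fun q _ => q.+1).

Lemma word_dfaP k s (w : seq 'I_k) :
  dfa_lang (word_dfa k s) w <-> map val w = decode s.
Proof.
set A := word_dfa k s; set l := sizec s.
(* The induction on [w] needs all starting states: from [q <= l] exactly the remaining suffix is
   accepted, from the sink nothing. *)
suff H (q : 'I_l.+2) : (foldl (@dfa_trans k A) q w \in dfa_final A) =
    (q <= l) && (map val w == drop q (decode s)).
  by rewrite /dfa_lang /= H /= drop0; split=> [/eqP|->].
elim: w q => [|a w IH] q /=.
  rewrite inE; case: (leqP q l) => [ql|lq]; last by rewrite gtn_eqF.
  by rewrite [[::] == _]eq_sym -size_eq0 size_drop subn_eq0 eqn_leq ql.
rewrite IH inordK ?ltnS ?geq_minr //; case: (ltnP q l) => ql /=; last first.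
  rewrite (minn_idPl _) // ltnn; case: (leqP q l) => //= lq.
  by rewrite drop_oversize.
rewrite (ltnW ql) (drop_nth 0 ql) eqseq_cons -/(nthc s q) [nthc s q == _]eq_sym.
case: eqP => _ /=; first by rewrite (minn_idPl _) ?ql // ltnW.
by rewrite (minn_idPl _) // ltnn.
Qed.

Lemma long_dfaP k N (w : seq 'I_k) : dfa_lang (long_dfa k N) w <-> N <= size w.
Proof.
set A := long_dfa k N.
suff H (q : 'I_N.+1) : (foldl (@dfa_trans k A) q w \in dfa_final A) = (N <= q + size w).
  by rewrite /dfa_lang /= H.
elim: w q => [|a w IH] q /=; first by rewrite inE addn0 eqn_leq -ltnS ltn_ord.
rewrite IH inordK ?ltnS ?geq_minr // addnS -addSn.
case: (leqP q.+1 N) => // Nq; rewrite leq_addr; symmetry.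
exact: leq_trans (ltnW Nq) (leq_addr _ _).
Qed.

Section Programs.

Variable C : language_class.
Implicit Types P : async_program C.

(** The indices are plain numbers because they will be read from certificates; out of range the
    language is empty. *)
Definition ctx_lang P (d a d' : nat) : language (nhandlers P) :=
  [set w | exists d0 a0 d0', [/\ val d0 = d, val a0 = a, val d0' = d' &
                               rep_lang (ctx d0 a0 d0' : representation C _) w]].

Arguments ctx_lang : clear implicits.

Lemma ctx_langE P (d d' : 'I_(nstates P)) (a : 'I_(nhandlers P)) :
  ctx_lang P d a d' = rep_lang (ctx d a d').
Proof.
apply/seteqP; split=> w; last by exists d, a, d'.
by case=> d0 [a0 [d0' [/val_inj-> /val_inj-> /val_inj->]]].
Qed.

(** This and the next two queries are phrased as emptiness or finiteness of languages, the form in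
    which they can be decided. *)
Definition mem_ctx P d a d' w :=
  ~~ `[< ctx_lang P d a d' `&` dfa_lang (word_dfa _ w) = set0 >].

Definition short_ctx P d a d' N :=
  `[< ctx_lang P d a d' `&` dfa_lang (long_dfa _ N) = set0 >].

Definition infinite_ctx P d a d' := ~~ `[< finite_set (ctx_lang P d a d') >].

Lemma mem_ctxP P d a d' w :
  mem_ctx P d a d' w <-> exists2 u, ctx_lang P d a d' u & map val u = decode w.
Proof.
split=> [/asboolPn/eqP/set0P[u [Lu /word_dfaP]]|[u Lu uw]]; first by exists u.
by apply/asboolPn/eqP/set0P; exists u; split=> //; apply/word_dfaP.
Qed.

Lemma short_ctxP P d a d' N :
  short_ctx P d a d' N <-> forall u, ctx_lang P d a d' u -> size u < N.
Proof.
split=> [/asboolP L0 u Lu|H].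
  by rewrite ltnNge; apply/negP => /long_dfaP uN; rewrite -[False]/(set0 u) -L0.
by apply/asboolP/seteqP; split=> // u [/H uN /long_dfaP]; rewrite leqNgt uN.
Qed.

Lemma nth_enum_map T (x0 : T) k (f : 'I_k -> T) (a : 'I_k) :
  nth x0 [seq f i | i <- enum 'I_k] a = f a.
Proof. by rewrite (nth_map a) ?size_enum_ord // nth_ord_enum. Qed.

Lemma enc_nstates P : nthc (enc_program P) 0 = nstates P.
Proof. by rewrite nthc_code. Qed.

Lemma enc_nhandlers P : nthc (enc_program P) 1 = nhandlers P.
Proof. by rewrite nthc_code. Qed.

Lemma enc_ctx P (d d' : 'I_(nstates P)) (a : 'I_(nhandlers P)) :
  nthc (nthc (nthc (nthc (enc_program P) 2) d) a) d' = rep_code (ctx d a d').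
Proof.
rewrite nthc_code [nth _ _ _]/= nthc_code nth_enum_map nthc_code nth_enum_map.
by rewrite nthc_code nth_enum_map.
Qed.

Lemma enc_init_state P : nthc (enc_program P) 3 = init_state P.
Proof. by rewrite nthc_code. Qed.

Lemma enc_init_mset P (a : 'I_(nhandlers P)) :
  nthc (nthc (enc_program P) 4) a = init_mset P a.
Proof. by rewrite nthc_code [nth _ _ _]/= nthc_code nth_enum_map. Qed.

Definition in_ctx P (d a d' : nat) : bool :=
  [&& d < nstates P, a < nhandlers P & d' < nstates P].

Lemma ctx_lang_out P d a d' : ~~ in_ctx P d a d' -> ctx_lang P d a d' = set0.
Proof.
move=> out; apply/seteqP; split=> // w [d0 [a0 [d0' [Ed Ea Ed' _]]]].
by case/negP: out; rewrite /in_ctx -Ed -Ea -Ed' !ltn_ord.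
Qed.

Hypotheses (hC : full_trio C) (finC : finiteness_decidable C).

Section Queries.

Variables (X : Type) (n : nat) (e : X -> n.-tuple nat).
Variables (P : X -> async_program C) (d a d' : X -> nat).
Hypothesis cP : comp e (fun x => enc_program (P x)).
Hypotheses (cd : comp e d) (ca : comp e a) (cd' : comp e d').

Lemma comp_nstates : comp e (fun x => nstates (P x)).
Proof. by apply: (comp_eq (fun x => enc_nstates (P x))); computable. Qed.

Lemma comp_nhandlers : comp e (fun x => nhandlers (P x)).
Proof. by apply: (comp_eq (fun x => enc_nhandlers (P x))); computable. Qed.

Let in_dom x := in_ctx (P x) (d x) (a x) (d' x).

Let comp_in_dom : comp e (fun x => in_dom x).
Proof.
have cn := comp_nstates; have ck := comp_nhandlers.
by rewrite /in_dom /in_ctx; computable.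
Qed.

(** A representation is available only for indices in range. Hence the subtype, which is also what
    the first branch of [comp_if] asks for. *)
Let r (y : {x | in_dom x}) : representation C (nhandlers (P (val y))) :=
  let: And3 hd ha hd' := elimT and3P (valP y) in
  ctx (Ordinal hd) (Ordinal ha) (Ordinal hd').

Let r_lang y :
  rep_lang (r y) = ctx_lang (P (val y)) (d (val y)) (a (val y)) (d' (val y)).
Proof. by rewrite /r; case: (elimT and3P _) => hd ha hd'; rewrite -ctx_langE. Qed.

Let comp_r : comp (fun y : {x | in_dom x} => e (val y)) (fun y => rep_code (r y)).
Proof.
pose F x := nthc (nthc (nthc (nthc (enc_program (P x)) 2) (d x)) (a x)) (d' x).
apply: (comp_eq (F := fun y => F (val y))) => [y|].
  by rewrite /r; case: (elimT and3P _) => hd ha hd'; rewrite -enc_ctx.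
by apply: comp_pre; rewrite /F; computable.
Qed.

Lemma comp_infinite_ctx :
  comp e (fun x => infinite_ctx (P x) (d x) (a x) (d' x)).
Proof.
apply: comp_not.
(* The default answer is 1: out of range the language is empty, hence finite. *)
apply: (comp_eq (F := fun x => if in_dom x then
    `[< finite_set (ctx_lang (P x) (d x) (a x) (d' x)) >] : nat else 1)) => [x|].
  by case: ifPn => // /ctx_lang_out ->; rewrite asboolT.
apply: comp_if (comp_const _ 1) => //.
have := comp_finite finC (comp_pre _ comp_nhandlers) comp_r.
by apply: comp_eq => y; rewrite r_lang.
Qed.

Lemma comp_ctx_empty (A : forall x, dfa (nhandlers (P x))) :
  comp e (fun x => enc_dfa (A x)) ->
  comp e (fun x => `[< ctx_lang (P x) (d x) (a x) (d' x) `&` dfa_lang (A x) = set0 >]).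
Proof.
move=> cA; apply: (comp_eq (F := fun x => if in_dom x then
    `[< ctx_lang (P x) (d x) (a x) (d' x) `&` dfa_lang (A x) = set0 >] : nat else 1)).
  by move=> x; case: ifPn => // /ctx_lang_out ->; rewrite set0I asboolT.
apply: comp_if (comp_const _ 1) => //.
have [I IE cI] := effective_inter_dfa hC.
have ck := comp_pre (fun y : {x | in_dom x} => val y) comp_nhandlers.
have cIr := cI _ _ _ _ r _ ck comp_r (comp_pre _ cA).
by apply: comp_eq (comp_empty hC finC ck cIr) => y; rewrite IE r_lang.
Qed.

Lemma comp_mem_ctx w :
  comp e w -> comp e (fun x => mem_ctx (P x) (d x) (a x) (d' x) (w x)).
Proof.
move=> cw; apply/comp_not/comp_ctx_empty; have ck := comp_nhandlers.
by apply: comp_natdfa; computable; apply: comp_ifn; computable.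
Qed.

Lemma comp_short_ctx N :
  comp e N -> comp e (fun x => short_ctx (P x) (d x) (a x) (d' x) (N x)).
Proof.
move=> cN; apply: comp_ctx_empty; have ck := comp_nhandlers.
by apply: comp_natdfa; computable.
Qed.

End Queries.

End Programs.

Arguments ctx_lang {C} P d a d' _.

(** * Unbounded programs have infinite contexts or self-covering runs *)

(** Past any [m] some index attains the minimum of the tail, so all later values are at least as
    large. Iterating this choice gives [phi]. *)
Lemma nondecreasing_subsequence (u : nat -> nat) :
  exists phi, (forall i, phi i < phi i.+1) /\ (forall i, u (phi i) <= u (phi i.+1)).
Proof.
have /choice[g Hg] m : exists i, m <= i /\ forall j, m <= j -> u i <= u j.
  have ex : exists v, `[< exists2 i, m <= i & u i = v >].
    by exists (u m); apply/asboolP; exists m.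
  case: (ex_minnP ex) => v /asboolP[i mi <-] vmin; exists i; split=> // j mj.
  by apply/vmin/asboolP; exists j.
pose p i := iter i (fun m => (g m).+1) 0.
have pS i : p i <= g (p i) < p i.+1 by rewrite ltnSn andbT; case: (Hg (p i)).
exists (g \o p); split=> i /=.
  by case/andP: (pS i) => _ /leq_trans; apply; case/andP: (pS i.+1).
apply: (Hg (p i)).2; case/andP: (pS i) => pg gp.
by apply: leq_trans pg (leq_trans (ltnW gp) _); case/andP: (pS i.+1).
Qed.

(** Each coordinate in turn thins out the subsequence, which keeps the coordinates treated before
    nondecreasing. The [foldr] is a conjunction over [fs]. *)
Lemma dickson T (fs : seq (T -> nat)) (s : nat -> T) :
  exists phi, (forall i, phi i < phi i.+1) /\
    foldr (fun f Q => (forall i, f (s (phi i)) <= f (s (phi i.+1))) /\ Q) True fs.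
Proof.
elim: fs => [|f fs [phi [phi_lt IH]]] /=; first by exists id.
have [psi [psi_lt f_le]] := nondecreasing_subsequence (f \o s \o phi).
have psi_le i : psi i <= psi i.+1 by apply: ltnW.
exists (phi \o psi); split; last split=> //.
  by move=> i /=; apply: (homo_ltn ltn_trans phi_lt).
elim: fs IH => //= h fs IH [h_le /IH]; split=> // i.
exact: (homo_leq (f := h \o s \o phi) leqnn leq_trans h_le).
Qed.

(** * Koenig's lemma for a finitely branching relation *)

Section Koenig.

Variables (T : Type) (R : T -> T -> Prop).

Inductive steps (t : T) : T -> Prop :=
| steps_refl : steps t t
| steps_next u u' : steps t u -> R u u' -> steps t u'.

Lemma steps_trans t u v : steps t u -> steps u v -> steps t v.
Proof. by move=> tu; elim=> [|w w' _]; [|apply: steps_next]. Qed.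

(** The set [h] will hold the nodes already used by a ray, so that the ray never repeats a node. *)
Inductive steps_avoiding (h : set T) (t : T) : T -> Prop :=
| avoiding_refl : ~ h t -> steps_avoiding h t t
| avoiding_next u u' : steps_avoiding h t u -> R u u' -> ~ h u' ->
    steps_avoiding h t u'.

Lemma avoiding_start h t u : steps_avoiding h t u -> ~ h t.
Proof. by elim. Qed.

(* Only the part after the last visit to [t] matters. *)
Lemma steps_avoiding_cons h t u :
  steps_avoiding h t u ->
  u = t \/ exists2 t', R t t' & steps_avoiding (h `|` [set t]) t' u.
Proof.
elim=> [_|v u' _ IH Rvu hu]; first by left.
have [->|ut] := pselect (u' = t); first by left.
have {}hu : ~ (h `|` [set t]) u' by case.
right; case: IH => [vt|[t' Rtt' Av]]; last by exists t' => //; apply: avoiding_next Av _ _.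
by exists u'; [rewrite -vt | apply: avoiding_refl].
Qed.

(** If infinitely many nodes were reachable, then [good] pairs, made of a history and a node with
    infinitely many nodes reachable outside the history, could be extended forever: among finitely
    many successors one is good again. This yields a ray without repetition. *)
Lemma koenig t0 :
  (forall u, steps t0 u -> finite_set [set u' | R u u']) ->
  (forall s : nat -> T, (forall i, steps t0 (s i)) ->
     (forall i, R (s i) (s i.+1)) -> ~ (forall i j, i < j -> s i <> s j)) ->
  finite_set [set u | steps t0 u].
Proof.
move=> fin_succ no_ray; apply: contrapT => inf.
pose good (p : set T * T) :=
  steps t0 p.2 /\ infinite_set [set u | steps_avoiding p.1 p.2 u].
have good0 : good (set0, t0).
  split; first exact: steps_refl.
  apply: sub_infinite_set inf => u; elim=> [|v v' _ Av Rv].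
    exact: avoiding_refl.
  exact: avoiding_next Av Rv _.
have /choice[g Hg] (p : {p | good p}) : exists q : {p | good p},
    R (sval p).2 (sval q).2 /\ (sval q).1 = (sval p).1 `|` [set (sval p).2].
  case: p => -[h t] [/= t0t inf_t].
  have [t' [Rtt' inf_t']] : exists t', R t t' /\
      infinite_set [set u | steps_avoiding (h `|` [set t]) t' u].
    apply: contrapT => no; apply: inf_t.
    apply: (@sub_finite_set _ _ ([set t] `|` \bigcup_(t' in [set t' | R t t'])
        [set u | steps_avoiding (h `|` [set t]) t' u])).
      by move=> u /steps_avoiding_cons[->|[t' Rtt' Au]]; [left|right; exists t'].
    rewrite finite_setU; split; first exact: finite_set1.
    apply: bigcup_finite; first exact: fin_succ.
    by move=> t' Rtt'; apply: contrapT => inf'; apply: no; exists t'.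
  have gq : good (h `|` [set t], t') by split=> //=; apply: steps_next Rtt'.
  by exists (exist _ _ gq).
pose p i := sval (iter i g (exist _ _ good0)).
have pR i : R (p i).2 (p i.+1).2 by case: (Hg (iter i g (exist _ _ good0))).
have pS i : (p i.+1).1 = (p i).1 `|` [set (p i).2].
  by case: (Hg (iter i g (exist _ _ good0))).
have p_good i : good (p i) by apply: svalP.
apply: (no_ray (fun i => (p i).2)) => // [i|i j ij pij]; first by case: (p_good i).
(* Earlier nodes of the ray lie in every later history, and a path avoiding that history cannot
   start there. *)
have pj : (p j).1 (p i).2.
  elim: j ij {pij} => // j IH; rewrite ltnS leq_eqVlt pS => /orP[/eqP->|/IH]; last by left.
  by right.
have [_ /infinite_setN0] := p_good j.
by case=> u /avoiding_start; rewrite -pij.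
Qed.

End Koenig.

(** * Runs of a program, pumping, and finiteness of the reachable part *)

Section Runs.

Variables (C : language_class) (P : async_program C).
Local Notation config := (config P).
Local Notation n := (nstates P).
Local Notation k := (nhandlers P).

Definition moves (c c' : config) : Prop := exists a, step a c c'.

Lemma reachableP c : reachable c <-> steps moves (init_state P, init_mset P) c.
Proof.
split; first by elim=> [|a u u' _ IH uu']; [left|apply: steps_next IH _; exists a].
by elim=> [|u u' _ IH [a uu']]; [left|apply: reachable_step IH uu'].
Qed.

(** A step with its word made explicit; the balance equation avoids both subtraction and the
    intermediate multiset, and is what certificates check. *)
Definition fires (c : config) (a : 'I_k) (u : seq 'I_k) (c' : config) : Prop :=
  [/\ 0 < c.2 a, rep_lang (ctx c.1 a c'.1) u &
      forall b, c'.2 b + (b == a) = c.2 b + count_mem b u].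

Lemma stepP a c c' : step a c c' <-> exists u, fires c a u c'.
Proof.
split=> [[m [m' [cm c'm [u Lu um]]]]|[u [ca Lu c'u]]].
  exists u; rewrite /fires cm c'm -um; split=> // [|b].
    by rewrite msetD ffunE eqxx addn1.
  by rewrite !msetD !ffunE addnAC.
exists [ffun b => c.2 b - (b == a)], (parikh u); split; last by exists u.
  by apply/ffunP => b; rewrite msetD !ffunE subnK //; case: eqP => // ->.
apply/ffunP => b; rewrite msetD !ffunE; apply/eqP; rewrite -(eqn_add2r (b == a)) c'u.
by rewrite addnAC subnK //; case: eqP => // ->.
Qed.

Lemma fires_exists (c : config) (a : 'I_k) d' u :
  0 < c.2 a -> rep_lang (ctx c.1 a d') u -> exists2 m, fires c a u (d', m) &
    size u <= mcard m.
Proof.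
move=> ca Lu; pose m : multiset k := [ffun b => c.2 b - (b == a) + count_mem b u].
exists m; first split=> // b.
  by rewrite ffunE addnAC subnK //; case: eqP => // ->.
rewrite -mcard_parikh; apply: leq_sum => b _.
by rewrite !ffunE leq_addl.
Qed.

Lemma fires_inj c a u c' c'' :
  fires c a u c' -> fires c a u c'' -> c'.1 = c''.1 -> c' = c''.
Proof.
case: c' c'' => [d m] [d' m'] [_ _ Hm] [_ _ Hm'] /= ->; congr (_, _).
by apply/ffunP => b; apply/eqP; rewrite -(eqn_add2r (b == a)) Hm Hm'.
Qed.

Lemma moves_add c c' x : moves c c' -> moves (c.1, c.2 + x)%R (c'.1, c'.2 + x)%R.
Proof.
case=> a /stepP[u [ca Lu c'u]]; exists a; apply/stepP; exists u; split=> //= [|b].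
  by rewrite msetD (leq_trans ca) ?leq_addr.
by rewrite !msetD addnAC c'u addnAC.
Qed.

Lemma steps_add c c' x :
  steps moves c c' -> steps moves (c.1, c.2 + x)%R (c'.1, c'.2 + x)%R.
Proof.
elim=> [|u u' _ IH uu']; first exact: steps_refl.
exact: steps_next IH (moves_add x uu').
Qed.

(** The run from [c] to [c'] can be repeated with its surplus [x] carried along, so all [m + x *+ i]
    are reachable, and [x] is positive at [b]. *)
Lemma self_cover_unbounded (c c' : config) (b : 'I_k) :
  reachable c -> steps moves c c' -> c.1 = c'.1 ->
  (forall a, c.2 a <= c'.2 a) -> c.2 b < c'.2 b -> ~ bounded P.
Proof.
case: c c' => [d m] [d' m'] /= Rc cc' dd' mm' mb [N HN]; subst d'.
pose x : multiset k := [ffun a => m' a - m a].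
have m'E : m' = (m + x)%R by apply/ffunP => a; rewrite msetD ffunE subnKC.
have pump i : reachable ((d, (m + x *+ i)%R) : config).
  elim: i => [|i IH]; first by rewrite GRing.mulr0n GRing.addr0.
  have := steps_add (x *+ i)%R cc'; rewrite m'E /= -GRing.addrA -GRing.mulrS.
  by move/reachableP in IH; move=> H; apply/reachableP; apply: steps_trans IH H.
have := HN _ (pump N.+1); rewrite /= mcardD leqNgt => /negP; apply.
apply: leq_trans (leq_addl _ _); rewrite /mcard (bigD1 b) //=.
apply: leq_trans (leq_addr _ _).
elim: N {HN} => [|N IH]; first by rewrite ffunE subn_gt0.
by rewrite GRing.mulrS msetD -add1n leq_add // ffunE subn_gt0.
Qed.

Lemma infinite_unbounded (c : config) a d' :
  reachable c -> 0 < c.2 a -> ~ finite_set (rep_lang (ctx c.1 a d')) -> ~ bounded P.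
Proof.
move=> Rc ca inf [N HN]; apply/inf/finite_languageP; exists N => u Lu.
have [m cm um] := fires_exists ca Lu; apply: leq_trans um (HN (d', m) _).
by apply: (reachable_step (a := a) Rc); apply/stepP; exists u.
Qed.

Lemma config_wqo (s : nat -> config) :
  exists i j, [/\ i < j, (s i).1 = (s j).1 & forall a, (s i).2 a <= (s j).2 a].
Proof.
(* The state enters both as [c.1] and as [n - c.1]: being nondecreasing in both means being
   constant. *)
pose fs := [:: fun c : config => val c.1, fun c : config => n - c.1 &
  [seq (fun c : config => c.2 a) | a <- enum 'I_k]].
have [phi [phi_lt /= [le1 [le2 le3]]]] := dickson fs s.
exists (phi 0), (phi 1); split=> // [|a].
  apply/val_inj/eqP; rewrite eqn_leq le1 /=.
  by rewrite -(leq_sub2lE _ (ltnW (ltn_ord _))) le2.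
have : a \in enum 'I_k by rewrite mem_enum.
by elim: (enum 'I_k) le3 => //= b l IH [Hb /IH Hl]; rewrite inE => /orP[/eqP->|].
Qed.

(** Finite contexts make the moves finitely branching. On a ray [config_wqo] finds two comparable
    configurations, which are equal by the second hypothesis, so Koenig's lemma applies. *)
Lemma finite_reachable :
  (forall (c : config) a d', reachable c -> 0 < c.2 a ->
     finite_set (rep_lang (ctx c.1 a d'))) ->
  (forall c c' : config, reachable c -> steps moves c c' -> c.1 = c'.1 ->
     (forall a, c.2 a <= c'.2 a) -> c.2 = c'.2) ->
  finite_set [set c : config | reachable c].
Proof.
move=> fin_ctx no_cover.
apply: (@sub_finite_set _ _ [set c | steps moves (init_state P, init_mset P) c]).
  by move=> c /reachableP.
apply: koenig => [c /reachableP Rc|s Rs ss dist].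
  (* Once handler and target state are fixed, a successor is a function of the word. *)
  pose F (p : 'I_k * 'I_n) : set config := if 0 < c.2 p.1 then
    (fun u => (p.2, [ffun b => c.2 b - (b == p.1) + count_mem b u])) @`
       rep_lang (ctx c.1 p.1 p.2) else set0.
  apply: (@sub_finite_set _ _ (\bigcup_p F p)).
    move=> [d' m] [a /stepP[u [ca Lu c'u]]]; exists (a, d') => //; rewrite /F /= ca.
    exists u => //; congr (_, _); apply/ffunP => b; rewrite ffunE; apply/eqP.
    by rewrite -(eqn_add2r (b == a)) c'u addnAC subnK //; case: eqP => // ->.
  apply: bigcup_finite => [|[a d'] _]; first exact: finite_finset.
  rewrite /F /=; case: ifP => // ca; exact/finite_image/fin_ctx.
have [i [j [ij dij mij]]] := config_wqo s.
have sij : steps moves (s i) (s j).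
  elim: j ij {dij mij} => // j IH; rewrite ltnS leq_eqVlt => /orP[/eqP->|/IH H].
    exact: steps_next (steps_refl _ _) _.
  exact: steps_next H _.
apply: (dist _ _ ij); have := no_cover _ _ (iffRL (reachableP _) (Rs i)) sij dij mij.
by case: (s i) (s j) dij => [d m] [d' m'] /= -> ->.
Qed.

Lemma bounded_finite : bounded P -> finite_set [set c : config | reachable c].
Proof.
case=> N HN; pose f (p : 'I_n * {ffun 'I_k -> 'I_N.+1}) : config :=
  (p.1, [ffun a => val (p.2 a)]).
apply: (@sub_finite_set _ _ (range f)); last exact/finite_image/finite_finset.
move=> [d m] /HN /= mN; exists (d, [ffun a => inord (m a)]) => //.
congr (_, _); apply/ffunP => a; rewrite ffunE /= ffunE inordK // ltnS (leq_trans _ mN) //.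
by rewrite /mcard (bigD1 a) //= leq_addr.
Qed.

Lemma finite_bounded : finite_set [set c : config | reachable c] -> bounded P.
Proof.
move=> /finite_seqP[l El]; exists (\max_(c <- l) mcard c.2) => c Rc.
have cl : [set` l] c by rewrite -El.
exact: (leq_bigmax_seq (F := fun c : config => mcard c.2) c).
Qed.

End Runs.

(** * Certificates *)

Definition countc w b := \sum_(i < sizec w) (nthc w i == b).

Lemma countc_code (k : nat) (u : seq 'I_k) (b : 'I_k) :
  countc (enc_word u) b = count_mem b u.
Proof.
rewrite /countc sizec_code -(big_mkord xpredT (fun i => (nthc _ i == b) : nat)) size_map.
rewrite (eq_bigr (fun i => nth 0 (map val u) i == b : nat)) => [|i _]; last first.
  by rewrite nthc_code.
elim: u => [|a u IH]; first by rewrite big_nil.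
by rewrite big_nat_recl //= IH.
Qed.

Lemma comp_countc X n (e : X -> n.-tuple nat) w b :
  comp e w -> comp e b -> comp e (fun x => countc (w x) (b x)).
Proof.
move=> cw cb; apply: (comp_sum (B := fun x i => nthc (w x) i == b x)); computable.
Qed.

Section Certificates.

Variables (C : language_class) (P : async_program C).
Local Notation config := (config P).
Local Notation n := (nstates P).
Local Notation k := (nhandlers P).

Definition cfg (c : config) : nat := code (val c.1 :: [seq c.2 a | a <- enum 'I_k]).

(** A relation, since a number found by search may carry further entries and need not be of the form
    [cfg c]. *)
Definition represents_config (s : nat) (c : config) : Prop :=
  nthc s 0 = c.1 /\ forall a : 'I_k, nthc s a.+1 = c.2 a.

Lemma cfgP c : represents_config (cfg c) c.
Proof. by split=> [|a]; rewrite nthc_code //= nth_enum_map. Qed.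

Definition init_cert (s : nat) : bool :=
  (nthc s 0 == nthc (enc_program P) 3) &&
  alln k (fun b => nthc s b.+1 == nthc (nthc (enc_program P) 4) b).

Definition step_cert (s a w s' : nat) : bool :=
  [&& 0 < nthc s a.+1, mem_ctx P (nthc s 0) a (nthc s' 0) w &
      alln k (fun b => nthc s' b.+1 + (b == a) == nthc s b.+1 + countc w b)].

Definition cover_cert (s s' : nat) : bool :=
  [&& nthc s 0 == nthc s' 0, alln k (fun b => nthc s b.+1 <= nthc s' b.+1) &
      hasn k (fun b => nthc s b.+1 < nthc s' b.+1)].

(** [short_ctx] limits the words to length below [N], and the bound on [w] exceeds all their codes
    by [leq_code_word]; this makes the quantifier over words finite. *)
Definition closed_cert (S N i a d' : nat) : bool :=
  (0 < nthc (nthc S i) a.+1) ==>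
  (short_ctx P (nthc (nthc S i) 0) a d' N &&
   alln (code (mkseq (fun=> k) N)).+1 (fun w =>
     mem_ctx P (nthc (nthc S i) 0) a d' w ==>
     hasn (sizec S) (fun j =>
       (nthc (nthc S j) 0 == d') && step_cert (nthc S i) a w (nthc S j)))).

(* [s] codes a pair of a length bound [N] and a list [S] of configurations that
   contains the initial one and is closed under steps. *)
Definition bounded_cert (s : nat) : bool :=
  hasn (sizec (nthc s 1)) (fun i => init_cert (nthc (nthc s 1) i)) &&
  alln (sizec (nthc s 1)) (fun i => alln k (fun a => alln n (fun d' =>
    closed_cert (nthc s 1) (nthc s 0) i a d'))).

Definition infinite_cert (s : nat) : bool :=
  hasn k (fun a => hasn n (fun d' =>
    (0 < nthc s a.+1) && infinite_ctx P (nthc s 0) a d')).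

(* [s] codes a pair of a bound on codes of words and a run, the last
   configuration of which enables an infinite context or covers an earlier
   one. *)
Definition unbounded_cert (s : nat) : bool :=
  [&& init_cert (nthc (nthc s 1) 0),
      alln (sizec (nthc s 1)).-1 (fun i => hasn k (fun a => hasn (nthc s 0) (fun w =>
        step_cert (nthc (nthc s 1) i) a w (nthc (nthc s 1) i.+1)))) &
      infinite_cert (nthc (nthc s 1) (sizec (nthc s 1)).-1) ||
      hasn (sizec (nthc s 1)) (fun i =>
        cover_cert (nthc (nthc s 1) i) (nthc (nthc s 1) (sizec (nthc s 1)).-1))].

Lemma init_certP s :
  init_cert s <-> represents_config s (init_state P, init_mset P).
Proof.
rewrite /init_cert enc_init_state; split=> [/andP[/eqP s0 /allnP sb]|[s0 sb]].
  by split=> //= a; rewrite (eqP (sb a (ltn_ord a))) enc_init_mset.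
rewrite s0 eqxx; apply/allnP => b bk.
by rewrite (sb (Ordinal bk)) -[X in nthc _ X]/(val (Ordinal bk)) enc_init_mset.
Qed.

(** Membership in the context forces the state of [s'] into range, so a configuration can be read
    off [s']. *)
Lemma step_cert_fires s c a w s' :
  represents_config s c -> step_cert s a w s' ->
  exists (a0 : 'I_k) u c', [/\ val a0 = a, map val u = decode w, fires c a0 u c' &
                               represents_config s' c'].
Proof.
case=> s0 sb /and3P[sa /mem_ctxP[u [d0 [a0 [d' [d0s aE d's Lu]]]] uw] /allnP H].
have s0E : c.1 = d0 by apply: val_inj; apply: etrans (esym s0) (esym d0s).
subst a d0; exists a0, u, (d', [ffun b => nthc s' (val b).+1]).
split=> //; last by split=> //= b; rewrite ffunE.
have wE : w = enc_word u by rewrite /enc_word uw CodeSeq.decodeK.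
split=> //= [|b]; first by rewrite -sb.
by rewrite ffunE -sb -countc_code -wE -(eqP (H b (ltn_ord b))).
Qed.

Lemma fires_step_cert s s' c c' (a : 'I_k) u :
  represents_config s c -> represents_config s' c' -> fires c a u c' ->
  step_cert s a (enc_word u) s'.
Proof.
move=> [s0 sb] [s0' sb'] [ca Lu H]; apply/and3P; split.
- by rewrite sb.
- by apply/mem_ctxP; exists u; rewrite ?CodeSeq.codeK // s0 s0' ctx_langE.
- apply/allnP => b bk; rewrite (sb (Ordinal bk)) (sb' (Ordinal bk)).
  by rewrite (countc_code u (Ordinal bk)) -H.
Qed.

(** Codes grow with the entries and with the length, and every letter is below [k]. *)
Lemma leq_code_word N (u : seq 'I_k) :
  size u < N -> enc_word u <= code (mkseq (fun=> k) N).
Proof.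
rewrite mkseq_const; elim: N u => // N IH [|a u] //= uN.
have := IH u uN; rewrite /enc_word /code /=.
set x := foldr _ _ _; set y := foldr _ _ _ => xy.
by rewrite leq_mul ?leq_exp2l ?(ltnW (ltn_ord a)) // ltnS leq_double.
Qed.

(** By induction on reachability every reachable configuration is listed, so the sum of all listed
    entries is a bound. *)
Lemma bounded_cert_sound s : bounded_cert s -> bounded P.
Proof.
set S := nthc s 1; case/andP=> /hasnP[i0 i0S /init_certP Si0] /allnP closed.
suff inS c : reachable c -> exists2 i, i < sizec S & represents_config (nthc S i) c.
  exists (\sum_(i < sizec S) \sum_(b < k) nthc (nthc S i) b.+1) => c /inS[i iS [_ Sb]].
  rewrite (bigD1 (Ordinal iS)) //=; apply: leq_trans (leq_addr _ _).
  by apply: leq_sum => b _; rewrite Sb.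
elim=> [|a c0 c1 _ [i iS Si] /stepP[u F]]; first by exists i0.
have [ca Lu _] := F; have [Si0' Sib] := Si.
have /allnP/(_ _ (ltn_ord a))/allnP/(_ _ (ltn_ord c1.1)) := closed _ iS.
rewrite /closed_cert Si0' Sib ca /= => /andP[/short_ctxP short /allnP H].
have Cu : ctx_lang P c0.1 a c1.1 u by rewrite ctx_langE.
have /H/implyP : enc_word u < (code (mkseq (fun=> k) (nthc s 0))).+1.
  by rewrite ltnS leq_code_word // short.
have Mu : mem_ctx P c0.1 a c1.1 (enc_word u).
  by apply/mem_ctxP; exists u; rewrite ?CodeSeq.codeK.
move=> /(_ Mu)/hasnP[j jS /andP[/eqP Sj0 /(step_cert_fires Si)]].
case=> a0 [v [c2 [/val_inj-> /esym]]]; rewrite CodeSeq.codeK => /(inj_map val_inj) <-.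
(* Handler, word and target state determine the successor, so the listed one is [c1]. *)
move=> F2 Sj; exists j => //; rewrite (fires_inj F F2) //.
by case: Sj => Sj _; apply: val_inj; apply: etrans (esym Sj0) Sj.
Qed.

Lemma bounded_cert_complete : bounded P -> exists s, bounded_cert s.
Proof.
move=> bP; have /finite_seqP[l El] := bounded_finite bP.
have lP c : reachable c <-> c \in l.
  by rewrite -[reachable c]/([set c : config | reachable c] c) El.
case: bP => N HN; pose S := code (map cfg l).
have SE c0 i : i < size l -> represents_config (nthc S i) (nth c0 l i).
  by move=> il; rewrite nthc_code (nth_map c0) //; apply: cfgP.
have SR c : reachable c -> exists2 i, i < size l & represents_config (nthc S i) c.
  move=> /lP cl; exists (index c l); first by rewrite index_mem.
  by have := SE c (index c l); rewrite index_mem nth_index //; apply.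
have szS : sizec S = size l by rewrite sizec_code size_map.
(* A spawned word is contained in a reachable configuration and so has length at most [N];
   [short_ctx] is strict, hence [N.+1]. *)
exists (code [:: N.+1; S]); rewrite /bounded_cert !nthc_code /= szS; apply/andP; split.
  have [|i il Si] := SR (init_state P, init_mset P); first exact: reachable_init.
  by apply/hasnP; exists i => //; apply/init_certP.
apply/allnP => i il; apply/allnP => a ak; apply/allnP => d' d'n.
have [S0 Sb] := SE (init_state P, init_mset P) i il.
set c := nth _ l i in S0 Sb; have Rc : reachable c by apply/lP/mem_nth.
apply/implyP; rewrite (Sb (Ordinal ak)) S0 => ca.
have fire u : ctx_lang P c.1 a d' u -> size u <= N /\ exists2 j, j < size l &
    nthc (nthc S j) 0 = d' /\ step_cert (nthc S i) a (enc_word u) (nthc S j).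
  rewrite (ctx_langE c.1 (Ordinal d'n) (Ordinal ak)) => Lu.
  have [m F um] := fires_exists ca Lu.
  have Rm : reachable (Ordinal d'n, m).
    by apply: (reachable_step (a := Ordinal ak) Rc); apply/stepP; exists u.
  split; first exact: leq_trans um (HN _ Rm).
  have [j jl Sj] := SR _ Rm; exists j => //; split; first by case: Sj.
  exact: (fires_step_cert (conj S0 Sb) Sj F).
apply/andP; split; first by apply/short_ctxP => u /fire[].
apply/allnP => w _; apply/implyP => /mem_ctxP[u Lu uw].
have [_ [j jl [Sj0 Sj]]] := fire u Lu; rewrite szS.
apply/hasnP; exists j => //; rewrite Sj0 eqxx /=.
by move: Sj; rewrite /enc_word uw CodeSeq.decodeK.
Qed.

Lemma unbounded_cert_sound s : unbounded_cert s -> ~ bounded P.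
Proof.
set S := nthc s 1; set m := (sizec S).-1.
case/and3P=> /init_certP S0 /allnP run.
(* Positions [i <= j] of the list represent configurations joined by a run. *)
have runs i j c : i <= j <= m -> represents_config (nthc S i) c ->
    exists2 c', steps (@moves _ P) c c' & represents_config (nthc S j) c'.
  case/andP=> ij jm Si; elim: j ij jm => [|j IH].
    by rewrite leqn0 => /eqP i0 _; exists c; [left | rewrite -i0].
  rewrite leq_eqVlt => /orP[/eqP <- _|]; first by exists c => //; left.
  rewrite ltnS => ij jm; have [c' cc' Sj] := IH ij (ltnW jm).
  have /hasnP[a _ /hasnP[w _ /(step_cert_fires Sj)]] := run j jm.
  case=> a0 [u [c'' [_ _ F Sj']]]; exists c'' => //.
  by apply: steps_next cc' _; exists a0; apply/stepP; exists u.
case/orP=> [/hasnP[a ak /hasnP[d' d'n /andP[]]]|/hasnP[i iS /and3P[]]].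
  have [|c /reachableP Rc [Sm0 Smb]] := runs 0 m _ _ S0; first by rewrite leqnn.
  rewrite Sm0 (Smb (Ordinal ak)) => ca.
  have -> : infinite_ctx P c.1 a d' = infinite_ctx P c.1 (Ordinal ak) (Ordinal d'n) by [].
  by rewrite /infinite_ctx ctx_langE => /asboolPn; apply: infinite_unbounded.
have im : i <= m by rewrite -ltnS prednK //; apply: leq_ltn_trans iS.
have [|c /reachableP Rc Si] := runs 0 i _ _ S0; first by rewrite im.
have [|c' cc' [Sm0 Smb]] := runs i m _ _ Si; first by rewrite im leqnn.
case: Si => Si0 Sib; rewrite Si0 Sm0 => /eqP/val_inj cc /allnP le /hasnP[b bk].
rewrite (Sib (Ordinal bk)) (Smb (Ordinal bk)) => lt_b.
apply: self_cover_unbounded Rc cc' cc _ lt_b => a.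
by rewrite -Sib -Smb le.
Qed.

Lemma steps_path (c c' : config) :
  steps (@moves _ P) c c' ->
  exists2 l, path (fun x y => `[< moves x y >]) c l & last c l = c'.
Proof.
elim=> [|u u' _ [l pl lu] uu']; first by exists [::].
exists (rcons l u'); last by rewrite last_rcons.
by rewrite rcons_path pl lu; apply/asboolP.
Qed.

(** Provides one bound on the codes of all words used along a run, the first component of an
    unboundedness certificate. *)
Lemma bound_witnesses (Q : nat -> nat -> Prop) m :
  (forall i, i < m -> exists w, Q i w) ->
  exists B, forall i, i < m -> exists2 w, w < B & Q i w.
Proof.
elim: m => [|m IH] H; first by exists 0.
have [|B HB] := IH; first by move=> i im; apply: H; apply: leqW.
have [w Qw] := H m (ltnSn m); exists (maxn B w.+1) => i.
rewrite ltnS leq_eqVlt => /orP[/eqP->|/HB[v vB Qv]]; first by exists w; rewrite ?leq_maxr.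
by exists v => //; apply: leq_trans vB (leq_maxl _ _).
Qed.

Lemma unbounded_cert_path (l : seq config) (c0 := (init_state P, init_mset P) : config) :
  path (fun x y => `[< moves x y >]) c0 l ->
  infinite_cert (cfg (last c0 l)) \/
    (exists2 c, c \in c0 :: l & cover_cert (cfg c) (cfg (last c0 l))) ->
  exists s, unbounded_cert s.
Proof.
move=> pl Hlast.
have [S SE szS] : exists2 S, forall i, i <= size l ->
    nthc S i = cfg (nth c0 (c0 :: l) i) & sizec S = (size l).+1.
  exists (code (map cfg (c0 :: l))) => [i il|]; last by rewrite sizec_code size_map.
  by rewrite nthc_code (nth_map c0).
have [|B HB] := @bound_witnesses (fun i w => hasn k (fun a =>
    step_cert (nthc S i) a w (nthc S i.+1))) (size l).
  move=> i il; have /(pathP c0)/(_ _ il)/asboolP[a /stepP[u F]] := pl.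
  exists (enc_word u); apply/hasnP; exists a => //.
  rewrite !SE ?(ltnW il) //; exact: fires_step_cert (cfgP _) (cfgP _) F.
exists (code [:: B; S]); rewrite /unbounded_cert !nthc_code /= szS /=; apply/and3P; split.
- by rewrite SE //; apply/init_certP/cfgP.
- apply/allnP => i /HB[w wB /hasnP[a ak H]].
  by apply/hasnP; exists a => //; apply/hasnP; exists w.
- rewrite SE // nth_last /=; apply/orP; case: Hlast => [|[c cl H]]; [by left|right].
  apply/hasnP; exists (index c (c0 :: l)); first by rewrite -index_mem in cl.
  by rewrite SE ?nth_index // -ltnS -[(size l).+1]/(size (c0 :: l)) index_mem.
Qed.

(** Without a certificate, reachable configurations enable only finite contexts and no run strictly
    covers itself, so [finite_reachable] would make the program bounded. *)
Lemma unbounded_cert_complete : ~ bounded P -> exists s, unbounded_cert s.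
Proof.
move=> unb; apply: contrapT => no; apply/unb/finite_bounded/finite_reachable.
  move=> c a d' /reachableP/steps_path[l pl lc] ca; apply: contrapT => inf.
  apply: no; apply: (unbounded_cert_path pl); left; rewrite lc.
  have [c0 cb] := cfgP c; apply/hasnP; exists a => //; apply/hasnP; exists d' => //.
  by rewrite cb ca c0 /infinite_ctx ctx_langE; apply/asboolPn.
move=> c c' /reachableP/steps_path[l pl lc] /steps_path[l' pl' lc'] dd' mm'.
apply/ffunP => b; apply/eqP; rewrite eqn_leq mm' leqNgt; apply/negP => lt_b.
(* The run to [c] followed by the run to [c'] ends in a configuration strictly above [c]. *)
apply: no; apply: (@unbounded_cert_path (l ++ l')).
  by rewrite cat_path pl lc.
right; exists c; first by rewrite -cat_cons mem_cat -lc mem_last.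
rewrite last_cat lc lc'; have [c0 cb] := cfgP c; have [c0' cb'] := cfgP c'.
apply/and3P; split; first by rewrite c0 c0' dd'.
  by apply/allnP => a ak; rewrite (cb (Ordinal ak)) (cb' (Ordinal ak)).
by apply/hasnP; exists b => //; rewrite cb cb'.
Qed.

End Certificates.

(** * Computability of the certificate checks and the decision procedure *)

Section Computability.

Variables (C : language_class) (hC : full_trio C) (finC : finiteness_decidable C).

Section Families.

Variables (X : Type) (n : nat) (e : X -> n.-tuple nat) (P : X -> async_program C).
Hypothesis cP : comp e (fun x => enc_program (P x)).

Lemma comp_init_cert s :
  comp e s -> comp e (fun x => init_cert (P x) (s x)).
Proof. by move=> cs; have ck := comp_nhandlers cP; rewrite /init_cert; computable. Qed.

Lemma comp_step_cert s a w s' :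
  comp e s -> comp e a -> comp e w -> comp e s' ->
  comp e (fun x => step_cert (P x) (s x) (a x) (w x) (s' x)).
Proof.
move=> cs ca cw cs'; have ck := comp_nhandlers cP;
apply: comp_and; first by computable.
apply: comp_and; first by apply: comp_mem_ctx => //; computable.
by computable; apply: comp_countc; computable.
Qed.

Lemma comp_cover_cert s s' :
  comp e s -> comp e s' -> comp e (fun x => cover_cert (P x) (s x) (s' x)).
Proof.
by move=> cs cs'; have ck := comp_nhandlers cP; rewrite /cover_cert; computable.
Qed.

End Families.

Ltac computable_cert :=
  repeat (cbv beta; first [ lazymatch goal with
  | |- comp _ (fun x => nat_of_bool (init_cert _ _)) => apply: comp_init_cert
  | |- comp _ (fun x => nat_of_bool (step_cert _ _ _ _ _)) => apply: comp_step_cert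
  | |- comp _ (fun x => nat_of_bool (cover_cert _ _ _)) => apply: comp_cover_cert
  | |- comp _ (fun x => nat_of_bool (mem_ctx _ _ _ _ _)) => apply: comp_mem_ctx => //
  | |- comp _ (fun x => nat_of_bool (short_ctx _ _ _ _ _)) =>
      apply: comp_short_ctx => //
  | |- comp _ (fun x => nat_of_bool (infinite_ctx _ _ _ _)) =>
      apply: comp_infinite_ctx => //
  | |- comp _ (fun x => (_).-1) => apply: comp_pred
  end | comp_step ]).

Lemma comp_bounded_cert X n (e : X -> n.-tuple nat) (P : X -> async_program C) s :
  comp e (fun x => enc_program (P x)) -> comp e s ->
  comp e (fun x => bounded_cert (P x) (s x)).
Proof.
move=> cP cs; have ck := comp_nhandlers cP; have cn := comp_nstates cP.
by rewrite /bounded_cert /closed_cert; computable_cert.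
Qed.

Lemma comp_unbounded_cert X n (e : X -> n.-tuple nat) (P : X -> async_program C) s :
  comp e (fun x => enc_program (P x)) -> comp e s ->
  comp e (fun x => unbounded_cert (P x) (s x)).
Proof.
move=> cP cs; have ck := comp_nhandlers cP; have cn := comp_nstates cP.
by rewrite /unbounded_cert /infinite_cert; computable_cert.
Qed.

Lemma boundedness_of_finiteness : boundedness_decidable C.
Proof.
apply/decidableP; set e := fun P => _.
have cP : comp e (@enc_program C) by exact: comp_eq (comp_tnth e ord0).
have c1 : comp (ext e) (fun y => bounded_cert y.1 y.2).
  by apply: comp_bounded_cert; computable.
have c2 : comp (ext e) (fun y => unbounded_cert y.1 y.2).
  by apply: comp_unbounded_cert; computable.
have [|F cF FP] := comp_search (p := fun P s => bounded_cert P s || unbounded_cert P s)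
    (comp_or c1 c2).
  move=> P; have [/bounded_cert_complete|/unbounded_cert_complete] := pselect (bounded P).
    by case=> s Hs; exists s; rewrite Hs.
  by case=> s Hs; exists s; rewrite Hs orbT.
have cPid : comp e (fun P => enc_program (id P)) by [].
(* The answer is whether the number found certifies boundedness; otherwise it certifies
   unboundedness, and soundness rules out the wrong answer. *)
apply: comp_eq (comp_bounded_cert cPid cF) => P; congr (nat_of_bool _).
apply/idP/asboolP; first exact: bounded_cert_sound.
by move=> bP; case/orP: (FP P) => // /unbounded_cert_sound.
Qed.

End Computability.

Theorem theorem4p3 (C : language_class) (hC : full_trio C) :
  boundedness_decidable C <-> finiteness_decidable C.
Proof.
split; first exact: finiteness_of_boundedness.
exact: boundedness_of_finiteness.
Qed.
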